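(* For every infinitesimally Kobayashi non-degenerate complex manifold $M$ it holds that $$\mathcal{B}(M)\subset\mathcal{SB}(M)\subset\mathcal{N}(M),$$ where $\mathcal{B}(M)$, $\mathcal{SB}(M)$ and $\mathcal{N}(M)$ denote respectively the sets of all Bloch functions, all semi-Bloch functions and all normal functions on $M$. Moreover, there are examples of infinitesimally Kobayashi non-degenerate complex manifolds $M$ for which these inclusions are proper.
   Context: $\mathbb{D}$ is the open unit disk in $\mathbb{C}$; $\hat{\mathbb{C}}$ is the Riemann sphere; $T_z(M)$ is the complex tangent space of $M$ at $z$; $f_*(z):T_z(M)\to T_{f(z)}(N)$ is the differential at $z$ of a holomorphic map $f:M\to N$ between complex manifolds. The symbol $\subset$ means inclusion, not necessarily strict. An analytic disk in $M$ is a holomorphic map $\phi:\mathbb{D}\to M$; $\phi'(\zeta)=\phi_*(\zeta)(e)$ with $e$ the canonical basis vector of the tangent space of $\mathbb{D}$ (identified with $\mathbb{C}$). The infinitesimal Kobayashi-Royden pseudometric is, for $z\in M$, $\xi\in T_z(M)$, $$k_M(z,\xi)=\inf\left\{\frac{1}{|a|} : \phi \text{ is an analytic disk in } M,\ \phi(0)=z,\ \phi'(0)=a\xi\right\}.$$ $M$ is infinitesimally Kobayashi non-degenerate if $k_M(z,\xi)>0$ for all $z\in M$ and $\xi\in T_z(M)\setminus\{0\}$. A holomorphic function $f:M\to\mathbb{C}$ is Bloch if there is a constant $C$ such that $|f_*(z)(\xi)|\le C\,k_M(z,\xi)$ for all $z\in M$, $\xi\in T_z(M)$. The infinitesimal spherical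 metric on $\hat{\mathbb{C}}$ is $\chi(w,\eta)=\frac{2|\eta|}{1+|w|^2}$ (extended to $w=\infty$ via the coordinate $1/w$). A meromorphic function $g:M\to\hat{\mathbb{C}}$ (a holomorphic map into the Riemann sphere; in particular any holomorphic function $M\to\mathbb{C}$) is normal if there is a constant $C$ such that $\chi(g(z),g_*(z)(\xi))\le C\,k_M(z,\xi)$ for all $z\in M$, $\xi\in T_z(M)$. A holomorphic function $f:M\to\mathbb{C}$ is semi-Bloch if for every $\lambda\in\mathbb{C}$ the function $g_\lambda(z)=\exp(\lambda f(z))$ is normal on $M$. *)

(* Defs.v *)
From HB Require Import structures.
From mathcomp Require Import all_boot all_order all_algebra.
From mathcomp Require Import complex.
From mathcomp Require Import all_classical all_reals all_analysis.

Set Implicit Arguments.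
Unset Strict Implicit.
Unset Printing Implicit Defensive.

Import Order.TTheory GRing.Theory Num.Theory.
Import numFieldNormedType.Exports.

Local Open Scope classical_set_scope.
Local Open Scope ring_scope.

(* numFieldNormedType puts the norm topology on abstract numFieldTypes only; the
   concrete field R[i] gets it from (R[i])^o in the same way. *)
HB.instance Definition _ (R : rcfType) :=
  PseudoPointedMetric.copy R[i] (R[i])^o.
HB.instance Definition _ (R : rcfType) := GRing.ComAlgebra.copy R[i] (R[i])^o.
HB.instance Definition _ (R : rcfType) := Vector.copy R[i] (R[i])^o.
HB.instance Definition _ (R : rcfType) := NormedModule.copy R[i] (R[i])^o.

(* A space with one chart selected around each of its points p: chart p is
   meaningful on chart_dom p, and chart_inv p on the image of chart_dom p; their
   values elsewhere are junk.  Every atlas can be refined to one of this form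
   that generates the same complex structure. *)
Record chartedSpace (R : realType) (V : normedModType R[i]) := ChartedSpace {
  carrier :> topologicalType;
  chart_dom : carrier -> set carrier;
  chart : carrier -> carrier -> V;
  chart_inv : carrier -> V -> carrier }.

(* Differentiability is Frechet differentiability over the field R[i], so on an
   open set it is holomorphy.  As the sets in open_chart_dom and open_chart_img
   are open, the pointwise continuity conditions say that each chart is a
   homeomorphism onto its image. *)
Record complex_manifold_axioms (R : realType) (V : normedModType R[i])
    (X : chartedSpace V) : Prop := ComplexManifoldAxioms {
  cm_hausdorff : hausdorff_space X;
  cm_second_countable : @second_countable X;
  chart_dom_center : forall p : X, chart_dom p p;
  open_chart_dom : forall p : X, open (chart_dom p);
  open_chart_img : forall p : X, open (chart p @` chart_dom p);
  chartK : forall p q : X, chart_dom p q -> chart_inv p (chart p q) = q;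
  continuous_chart : forall p q : X,
    chart_dom p q -> {for q, continuous (chart p)};
  continuous_chart_inv : forall p q : X,
    chart_dom p q -> {for chart p q, continuous (chart_inv p)};
  holomorphic_transition : forall p q x : X,
    chart_dom p x -> chart_dom q x ->
    differentiable (chart q \o chart_inv p) (chart p x) }.

Record complexManifold (R : realType) := ComplexManifold {
  cm_dim : nat;
  cm_space :> chartedSpace 'rV[R[i]]_cm_dim;
  cm_axioms : complex_manifold_axioms cm_space }.

(* The tangent space at z is identified with the model space through the
   differential at z of the selected chart around z. *)
Definition tangent (R : realType) (V : normedModType R[i])
  (X : chartedSpace V) (z : X) : normedModType R[i] := V.

Section Maps.
Variables (R : realType) (V W : normedModType R[i]).
Variables (X : chartedSpace V) (Y : chartedSpace W).

Definition local_rep (f : X -> Y) (z : X) : V -> W :=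
  chart (f z) \o f \o chart_inv z.

(* To be used with A open. *)
Definition holomorphic_on (A : set X) (f : X -> Y) :=
  forall z, A z ->
    {for z, continuous f} /\ differentiable (local_rep f z) (chart z z).

Definition holomorphic (f : X -> Y) := holomorphic_on setT f.

Definition differential (f : X -> Y) (z : X) (xi : tangent z) :
  tangent (f z) := 'd (local_rep f z) (chart z z) xi.

End Maps.

Definition complex_plane (R : realType) : chartedSpace R[i] :=
  @ChartedSpace R R[i] R[i] (fun=> setT) (fun=> id) (fun=> id).

(* The point None is infinity.  The coordinate is w around a finite point, and
   1/w around infinity; the latter is used on the complement of 0. *)
Definition sphere_dom (R : realType)
    (p : one_point_compactification R[i]) :
    set (one_point_compactification R[i]) :=
  if p is Some _ then [set~ None] else [set~ Some 0].

Definition sphere_chart (R : realType)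
    (p q : one_point_compactification R[i]) : R[i] :=
  match p, q with
  | Some _, Some w => w
  | None, Some w => w^-1
  | _, None => 0
  end.

Definition sphere_chart_inv (R : realType)
    (p : one_point_compactification R[i]) (w : R[i]) :
    one_point_compactification R[i] :=
  if p is Some _ then Some w else if w == 0 then None else Some w^-1.

Definition riemann_sphere (R : realType) : chartedSpace R[i] :=
  @ChartedSpace R R[i] (one_point_compactification R[i])
    (@sphere_dom R) (@sphere_chart R) (@sphere_chart_inv R).

Definition to_sphere (R : realType) (w : complex_plane R) : riemann_sphere R :=
  Some w.

(* At infinity chart w w = 0, which gives the value of the metric in the
   coordinate 1/w. *)
Definition spherical_metric (R : realType) (w : riemann_sphere R)
    (eta : tangent w) : R :=
  2 * Normc.normc eta / (1 + Normc.normc (chart w w) ^+ 2).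

Definition cexp (R : realType) (z : R[i]) : R[i] :=
  Complex (expR (complex.Re z) * cos (complex.Im z))
          (expR (complex.Re z) * sin (complex.Im z)).

Section BlochNormal.
Variables (R : realType) (M : complexManifold R).

Definition unit_disk : set (complex_plane R) :=
  [set zeta | Normc.normc zeta < 1].

(* Only the values of phi on the unit disk matter. *)
Definition analytic_disk (phi : complex_plane R -> M) :=
  holomorphic_on unit_disk phi.

(* The condition a != 0 excludes a = 0, where 1/|a| stands for +oo whereas
   0^-1 = 0 here.  The set is never empty, because of the disks that are
   affine in a chart, so inf is the true infimum. *)
Definition kobayashi (z : M) (xi : tangent z) : R :=
  inf [set r | exists (phi : complex_plane R -> M) (a : R[i]),
    [/\ analytic_disk phi, phi 0 = z, a != 0,
        @differential _ _ _ _ _ phi 0 1 = a *: xi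
      & r = (Normc.normc a)^-1] ].

Definition kobayashi_nondegenerate : Prop :=
  forall (z : M) (xi : tangent z), xi != 0 -> 0 < kobayashi xi.

Definition bloch (f : M -> complex_plane R) :=
  holomorphic f /\
  exists C : R, forall (z : M) (xi : tangent z),
    Normc.normc (differential f xi) <= C * kobayashi xi.

Definition normal (g : M -> riemann_sphere R) :=
  holomorphic g /\
  exists C : R, forall (z : M) (xi : tangent z),
    spherical_metric (differential g xi) <= C * kobayashi xi.

Definition semi_bloch (f : M -> complex_plane R) :=
  holomorphic f /\
  forall lambda : R[i],
    normal (fun z => to_sphere (cexp (lambda * (f z : R[i])))).

Definition bloch_functions : set (M -> complex_plane R) := [set f | bloch f].

Definition semi_bloch_functions : set (M -> complex_plane R) :=
  [set f | semi_bloch f].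

Definition normal_functions : set (M -> complex_plane R) :=
  [set f | holomorphic f /\ normal (@to_sphere R \o f)].

End BlochNormal.

Arguments kobayashi_nondegenerate {R} M.
Arguments bloch_functions {R} M.
Arguments semi_bloch_functions {R} M.
Arguments normal_functions {R} M.

(* Main.v *)
Require Import Defs.
From HB Require Import structures.
From mathcomp Require Import all_boot all_order all_algebra.
From mathcomp Require Import complex.
From mathcomp Require Import all_classical all_reals all_analysis.
From mathcomp Require Import ring lra.

(* Inclusions.  With g = exp(lambda f) one has chi(g, dg) <= |lambda| |df|, which
   gives Bloch => semi-Bloch.  Conversely only lambda = 1 is needed for
   semi-Bloch => normal: along an analytic disk phi, h = f o phi satisfies
   |h'| <= K (e^u + e^-u) with u = Re h on |z| < 1/2, and this forces
   |h'(0)| <= C (1 + |u(0)|).  Indeed, let r be the radius of the largest disk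
   about 0 on which u > 1 (if u(0) is large).  There Borel-Caratheodory gives
   |h'| <= 2 u / dist, so u decays at most quadratically towards the boundary of
   that disk, while the hypothesis makes -1/(1 + e^u) Lipschitz along rays; the
   two bounds give u(0) = O(r^2) and |h'(0)| <= 2 u(0) / r = O(1).

   Borel-Caratheodory needs Cauchy's theorem for functions that are merely
   complex differentiable.  Goursat's quadrisection is applied in the coordinate
   log z; contour integrals are second differences of primitives.

   Example.  On the strip |Im w| < 1, (w + 2i)^2 is semi-Bloch but not Bloch, and
   w^2 is normal but not semi-Bloch (take lambda = i on the real axis). *)

Set Implicit Arguments.
Unset Strict Implicit.
Unset Printing Implicit Defensive.

Import Order.TTheory GRing.Theory Num.Theory.
Import numFieldNormedType.Exports.

Local Open Scope classical_set_scope.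
Local Open Scope ring_scope.

(** How the two bounds combine: put A = u(0) and let r be the radius of the largest disk. By the
    quadratic decay, u is still at least 2 on each ray at distance r sqrt(2 / A) from the rim, while
    points with u <= 1 lie arbitrarily close to the rim. So -1/(1 + e^u) changes by a fixed amount
    over a length of about r sqrt(2 / A), and its Lipschitz bound forces A = O(r^2).

    The resulting estimate is linear in u(0). It yields |df| <= C (1 + |f|) k, where normality would
    allow 1 + |f|^2; this margin is why information on Re f alone, from a single lambda, is enough.

    Borel-Caratheodory is reached without an integral formula. It follows from a minimum principle
    on circles for functions that are differentiable off 0 and only continuous at 0. The point 0 is
    harmless because log z sends it to infinity, and it has to be allowed because the principle is
    applied to a combination of h with its difference quotient at 0. *)

Local Notation normc := Normc.normc.
Local Notation cRe := complex.Re.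
Local Notation cIm := complex.Im.
Local Notation "x %:C" := (real_complex _ x) : ring_scope.

(** * Modulus, real and imaginary parts, complex derivatives *)

Section ComplexBasics.
Context {R : realType}.
Implicit Types (z w : R[i]) (x y : R).

Lemma normCE z : `|z| = (normc z)%:C.
Proof. by []. Qed.

Lemma normc_ge0 z : 0 <= normc z.
Proof. by case: z => a b; apply: sqrtr_ge0. Qed.

Lemma normc_eq0 z : (normc z == 0) = (z == 0).
Proof.
by apply/eqP/eqP => [/Normc.eq0_normc //|->]; rewrite Normc.normc0.
Qed.

Lemma normc_gt0 z : (0 < normc z) = (z != 0).
Proof. by rewrite lt_neqAle normc_ge0 andbT eq_sym normc_eq0. Qed.

Lemma normc_sqr z : normc z ^+ 2 = cRe z ^+ 2 + cIm z ^+ 2.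
Proof. by case: z => a b; rewrite /= sqr_sqrtr // addr_ge0 // sqr_ge0. Qed.

Lemma normcD z w : normc (z + w) <= normc z + normc w.
Proof. exact: le_normcD. Qed.

Lemma normcN z : normc (- z) = normc z.
Proof. exact: normcN. Qed.

Lemma normcB_sym z w : normc (z - w) = normc (w - z).
Proof. by rewrite -opprB normcN. Qed.

Lemma normcM z w : normc (z * w) = normc z * normc w.
Proof. exact: Normc.normcM. Qed.

Lemma normcV z : normc z^-1 = (normc z)^-1.
Proof. exact: Normc.normcV. Qed.

Lemma normcX z n : normc (z ^+ n) = normc z ^+ n.
Proof.
by elim: n => [|n IH]; rewrite ?expr0 ?Normc.normc1 // !exprS normcM IH.
Qed.

Lemma normcR x : normc x%:C = `|x|.
Proof. by rewrite /= expr0n addr0 sqrtr_sqr. Qed.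

Lemma cReD z w : cRe (z + w) = cRe z + cRe w. Proof. by case: z; case: w. Qed.
Lemma cImD z w : cIm (z + w) = cIm z + cIm w. Proof. by case: z; case: w. Qed.
Lemma cReN z : cRe (- z) = - cRe z. Proof. by case: z. Qed.
Lemma cImN z : cIm (- z) = - cIm z. Proof. by case: z. Qed.
Lemma cReM z w : cRe (z * w) = cRe z * cRe w - cIm z * cIm w.
Proof. by case: z; case: w. Qed.
Lemma cImM z w : cIm (z * w) = cRe z * cIm w + cIm z * cRe w.
Proof. by case: z => a b; case: w => c d /=. Qed.

Lemma eq_ReIm z w : cRe z = cRe w -> cIm z = cIm w -> z = w.
Proof. by case: z => a b; case: w => c d /= -> ->. Qed.

Lemma normc_Re z : `|cRe z| <= normc z.
Proof.
rewrite -ler_sqr ?nnegrE ?normc_ge0 // normc_sqr real_normK ?num_real //.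
by rewrite lerDl sqr_ge0.
Qed.

Lemma normc_Im z : `|cIm z| <= normc z.
Proof.
rewrite -ler_sqr ?nnegrE ?normc_ge0 // normc_sqr real_normK ?num_real //.
by rewrite lerDr sqr_ge0.
Qed.

Lemma normc_le_ReIm z : normc z <= `|cRe z| + `|cIm z|.
Proof.
rewrite -ler_sqr ?nnegrE ?normc_ge0 ?addr_ge0 // normc_sqr sqrrD.
by rewrite !real_normK ?num_real // -addrA lerD2l lerDr mulrn_wge0 // mulr_ge0.
Qed.

Lemma posC_real (e : R[i]) : 0 < e -> 0 < cRe e /\ e = (cRe e)%:C.
Proof.
by case: e => a b; rewrite ltcE /= => /andP[/eqP-> a0].
Qed.

Lemma nbhsCP z (A : set R[i]) :
  nbhs z A <-> exists2 e : R, 0 < e & forall w, normc (w - z) < e -> A w.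
Proof.
split=> [/nbhs_normP[e /= /posC_real[e0 ee] H]|[e e0 H]].
  exists (cRe e) => // w wz; apply: H; 
  by rewrite /= ee normCE ltcR normcB_sym.
apply/nbhs_normP; exists (e%:C) => [/=|w]; first by rewrite ltcR.
by rewrite /= normCE ltcR => wz; apply: H; rewrite normcB_sym.
Qed.

Lemma continuousCP (f : R[i] -> R[i]) z : {for z, continuous f} <->
  forall e : R, 0 < e -> exists2 d : R, 0 < d &
    forall w, normc (w - z) < d -> normc (f w - f z) < e.
Proof.
split=> [fz e e0|H A /nbhsCP[e e0 eA]].
  have /fz /nbhsCP[d d0 H] : nbhs (f z) [set w | normc (w - f z) < e].
    by apply/nbhsCP; exists e.
  by exists d.
have [d d0 Hd] := H e e0.
by apply/nbhsCP; exists d => // w /Hd /eA.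
Qed.

(** Frechet differentiability over [R[i]] with real epsilons and the derivative as an explicit
    number, so that estimates take place in the ordered field [R]. The inequality is not strict, so
    w = z need not be excluded. *)
Definition cdiff (f : R[i] -> R[i]) z (c : R[i]) :=
  forall e : R, 0 < e -> exists2 d : R, 0 < d &
    forall w, normc (w - z) < d ->
      normc (f w - f z - c * (w - z)) <= e * normc (w - z).

Lemma diffC1 (f : R[i] -> R[i]) z w : differentiable f z ->
  'd f z w = 'd f z 1 * w.
Proof.
by move=> df; rewrite mulrC -[in LHS](mulr1 w) -[w * 1]/(w *: (1 : R[i])) linearZ.
Qed.

Lemma differentiable_cdiff (f : R[i] -> R[i]) z : differentiable f z ->
  cdiff f z ('d f z 1).
Proof.
move=> df e e0.
have /eqaddoP /(_ (e%:C)) : f \o shift z = cst (f z) + 'd f z +o_ 0 id.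
  exact: diff_locally.
rewrite ltcR => /(_ e0) /nbhsCP[d d0 H].
exists d => // w wz; have := H (w - z); rewrite /= subr0 => /(_ wz).
rewrite !fctE subrK.
by rewrite !normCE -rmorphM lecR diffC1 // opprD addrA.
Qed.

Lemma cdiff_is_diff (f : R[i] -> R[i]) z c : cdiff f z c ->
  differentiable f z /\ 'd f z 1 = c.
Proof.
move=> fc.
have cc : continuous ( *:%R c : R[i] -> R[i]) by exact: scaler_continuous.
have E : f \o shift z = cst (f z) + ( *:%R c : R[i] -> R[i]) +o_ 0 id.
  apply/eqaddoP => e /posC_real[e0 ->].
  have [d d0 H] := fc _ e0.
  apply/nbhsCP; exists d => // w; rewrite subr0 => wd.
  have := H (w + z); rewrite addrK => /(_ wd).
  by rewrite -lecR rmorphM -!normCE -addrA -opprD.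
have dfE := diff_unique cc E.
split; last by rewrite dfE; exact: mulr1.
by apply/diff_locallyP; rewrite dfE; split.
Qed.

End ComplexBasics.

(** * Real derivatives, primitives and the mean value theorem *)

Section RealDiff.
Context {R : realType}.
Implicit Types (f : R -> R) (x y : R).

Lemma continuousRP f x : {for x, continuous f} <->
  forall e : R, 0 < e -> exists2 d : R, 0 < d &
    forall y, `|y - x| < d -> `|f y - f x| < e.
Proof.
split=> [fx e e0|H].
  have /cvgrPdist_lt/(_ e e0)/nbhs_normP[d /= d0 Hd] := fx.
  exists d => // y yx; rewrite distrC; apply: Hd => /=.
  by rewrite distrC.
apply/cvgrPdist_lt => e e0; have [d d0 Hd] := H e e0.
apply/nbhs_normP; exists d => //= y yx.
by rewrite distrC; apply: Hd; rewrite distrC.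
Qed.

Lemma is_deriveRP f x (df : R) : is_derive x 1 f df <->
  forall e : R, 0 < e -> exists2 d : R, 0 < d &
    forall y, `|y - x| < d ->
      `|f y - f x - df * (y - x)| <= e * `|y - x|.
Proof.
split=> [[fx dfx] e e0|fx].
  move/derivable1_diffP in fx.
  have /eqaddoP /(_ e e0) /nbhs_normP[d /= d0 H] :
    f \o shift x = cst (f x) + 'd f x +o_ 0 id by exact: diff_locally.
  exists d => // y yx; have := H (y - x); rewrite /= sub0r normrN => /(_ yx).
  rewrite !fctE subrK deriv1E; last exact/derivable1_diffP.
  by rewrite derive1E dfx opprD addrA -[_ *: _]/(_ * _) mulrC [df * _]mulrC.
have cc : continuous ( *:%R df : R -> R) by exact: scaler_continuous.
have E : f \o shift x = cst (f x) + ( *:%R df : R -> R) +o_ 0 id.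
  apply/eqaddoP => e e0; have [d d0 H] := fx _ e0.
  apply/nbhs_normP; exists d => // w /=; rewrite sub0r normrN => wd.
  have := H (w + x); rewrite addrK => /(_ wd).
  by rewrite -addrA -opprD.
have dfE := diff_unique cc E.
have dx : differentiable f x by apply/diff_locallyP; rewrite dfE; split.
apply: DeriveDef; first exact/derivable1_diffP.
by rewrite deriveE // dfE; exact: mulr1.
Qed.

(** The integral from [a] is known to be differentiable only strictly to the right of [a]; it is
    therefore started one unit before the interval of interest. *)
Lemma primitive_exists f (a : R) : continuous f ->
  exists F : R -> R, forall x, a < x -> is_derive x 1 F (f x).
Proof.
move=> cf.
exists (fun x => \int[lebesgue_measure]_(t in `[a, x]) f t) => x ax.
have [] := @continuous_FTC1_closed R f a x (x + 1).
- by rewrite ltrDl.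
- apply: continuous_compact_integrable; first exact: segment_compact.
  exact: continuous_subspaceT.
- exact: ax.
- exact: cf.
by move=> d1 d2; apply: DeriveDef => //; rewrite -derive1E.
Qed.

Lemma MVT_le (F f : R -> R) (a b : R) : a <= b ->
  (forall x, a <= x <= b -> is_derive x 1 F (f x)) ->
  exists2 c, a <= c <= b & F b - F a = f c * (b - a).
Proof.
move=> ab H.
have dF x : x \in `]a, b[%R -> is_derive x 1 F (f x).
  by rewrite in_itv /= => /andP[ax xb]; apply: H; rewrite !ltW.
have cF : {within `[a, b], continuous F}.
  apply: derivable_within_continuous => x; rewrite in_itv /= => xab.
  by have := H x xab => -[].
have [c cab ->] := MVT_segment ab dF cF.
by exists c.
Qed.

End RealDiff.

(** * Rules for complex derivatives; the exponential *)

Section ComplexDiff.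
Context {R : realType}.
Implicit Types (f g : R[i] -> R[i]) (z c d : R[i]).

Lemma cdiff_lip f z c : cdiff f z c -> exists2 d : R, 0 < d &
  forall w, normc (w - z) < d ->
    normc (f w - f z) <= (normc c + 1) * normc (w - z).
Proof.
move=> /(_ 1 ltr01)[d d0 H]; exists d => // w /H; rewrite mul1r => Hw.
rewrite -[f w - f z](subrK (c * (w - z))).
by apply: (le_trans (normcD _ _)); rewrite normcM mulrDl mul1r addrC lerD2l.
Qed.

Lemma cdiff_cont f z c : cdiff f z c -> forall e : R, 0 < e ->
  exists2 d : R, 0 < d & forall w, normc (w - z) < d -> normc (f w - f z) < e.
Proof.
move=> /cdiff_lip[d d0 H] e e0; have c0 := normc_ge0 c.
have c1 : 0 < normc c + 1 by lra.
exists (Num.min d (e / (normc c + 1))) => [|w].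
  by rewrite lt_min d0 divr_gt0.
rewrite lt_min => /andP[/H wd we]; apply: (le_lt_trans wd).
by rewrite mulrC -ltr_pdivlMr.
Qed.

Lemma cdiff_comp f g z c d : cdiff f z c -> cdiff g (f z) d ->
  cdiff (g \o f) z (d * c).
Proof.
move=> fc gd e e0; have c0 := normc_ge0 c; have d0 := normc_ge0 d.
have K : 0 < normc c + normc d + 1 by lra.
pose e1 := e / (normc c + normc d + 1).
have e10 : 0 < e1 by rewrite divr_gt0.
have eE : e = e1 * (normc c + normc d + 1) by rewrite divfK // gt_eqF.
have [r1 r10 H1] := fc _ e10.
have [r2 r20 H2] := cdiff_lip fc.
have [r3 r30 H3] := gd _ e10.
have [r4 r40 H4] := cdiff_cont fc r30.
exists (Num.min r1 (Num.min r2 r4)) => [|w]; first by rewrite !lt_min r10 r20.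
rewrite !lt_min => /and3P[/H1 h1 /H2 h2 /H4/H3 h3] /=.
have -> : g (f w) - g (f z) - d * c * (w - z) =
  (g (f w) - g (f z) - d * (f w - f z)) + d * (f w - f z - c * (w - z)) by ring.
apply: (le_trans (normcD _ _)); rewrite normcM.
have N0 := normc_ge0 (w - z).
have A1 : e1 * normc (f w - f z) <= e1 * ((normc c + 1) * normc (w - z)).
  by rewrite ler_wpM2l // ltW.
have A2 := ler_wpM2l d0 h1.
rewrite eE; apply: (le_trans (lerD (le_trans h3 A1) A2)).
by rewrite le_eqVlt; apply/orP; left; apply/eqP; ring.
Qed.

Lemma cdiffD f g z c d : cdiff f z c -> cdiff g z d ->
  cdiff (fun w => f w + g w) z (c + d).
Proof.
move=> fc gd e e0; have e20 : 0 < e / 2 by rewrite divr_gt0.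
have [r1 r10 H1] := fc _ e20; have [r2 r20 H2] := gd _ e20.
exists (Num.min r1 r2) => [|w]; first by rewrite lt_min r10.
rewrite lt_min => /andP[/H1 h1 /H2 h2].
have -> : f w + g w - (f z + g z) - (c + d) * (w - z) =
  (f w - f z - c * (w - z)) + (g w - g z - d * (w - z)) by ring.
by apply: (le_trans (normcD _ _)); lra.
Qed.

Lemma cdiff_cst (a : R[i]) z : cdiff (fun=> a) z 0.
Proof.
move=> e e0; exists 1 => // w _.
by rewrite subrr mul0r subr0 Normc.normc0 mulr_ge0 ?normc_ge0 // ltW.
Qed.

Lemma cdiff_id z : cdiff id z 1.
Proof.
move=> e e0; exists 1 => // w _.
by rewrite mul1r subrr Normc.normc0 mulr_ge0 ?normc_ge0 // ltW.
Qed.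

Lemma cdiffM f g z c d : cdiff f z c -> cdiff g z d ->
  cdiff (fun w => f w * g w) z (c * g z + f z * d).
Proof.
move=> fc gd e e0; have c0 := normc_ge0 c; have d0 := normc_ge0 d.
have f0 := normc_ge0 (f z); have g0 := normc_ge0 (g z).
set K := normc (f z) + normc (g z) + 1.
have K0 : 0 < K by rewrite /K; lra.
set L := (normc c + 1) * (normc d + 1).
have L0 : 0 < L by rewrite mulr_gt0 //; lra.
pose e1 := e / 2 / K.
have e10 : 0 < e1 by rewrite !divr_gt0.
have eE : e = 2 * (e1 * K) by rewrite divfK ?gt_eqF //; field.
have [r1 r10 H1] := fc _ e10; have [r2 r20 H2] := gd _ e10.
have [r3 r30 H3] := cdiff_lip fc; have [r4 r40 H4] := cdiff_lip gd.
have r50 : 0 < e1 * K / L by rewrite divr_gt0 // mulr_gt0.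
exists (Num.min (e1 * K / L) (Num.min r1 (Num.min r2 (Num.min r3 r4)))) => [|w].
  by rewrite !lt_min r10 r20 r30 r40 r50.
rewrite !lt_min => /and5P[h5 /H1 h1 /H2 h2 /H3 h3 /H4 h4].
have -> : f w * g w - f z * g z - (c * g z + f z * d) * (w - z) =
  (f w - f z - c * (w - z)) * g z + f z * (g w - g z - d * (w - z)) +
  (f w - f z) * (g w - g z) by ring.
have N0 := normc_ge0 (w - z).
set N := normc (w - z) in N0 h1 h2 h3 h4 h5 *.
apply: (le_trans (normcD _ _)); rewrite [X in _ + X]normcM.
have A1 : normc (f w - f z) * normc (g w - g z) <= e1 * K * N.
  apply: (le_trans (ler_pM (normc_ge0 _) (normc_ge0 _) h3 h4)).
  have -> : (normc c + 1) * N * ((normc d + 1) * N) = (L * N) * N by rewrite /L; ring.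
  by rewrite ler_wpM2r // mulrC -ler_pdivlMr // ltW.
have A2 := normcD ((f w - f z - c * (w - z)) * g z) (f z * (g w - g z - d * (w - z))).
rewrite !normcM in A2.
have A3 := ler_wpM2r g0 h1; have A4 := ler_wpM2l f0 h2.
have A5 : e1 * N * normc (g z) + normc (f z) * (e1 * N) <= e1 * K * N.
  have -> : e1 * K * N = e1 * N * normc (g z) + normc (f z) * (e1 * N) + e1 * N.
    by rewrite /K; ring.
  by rewrite lerDl mulr_ge0 // ltW.
rewrite eE; lra.
Qed.

Lemma cdiffMl (a : R[i]) f z c : cdiff f z c -> cdiff (fun w => a * f w) z (a * c).
Proof. by move=> fc; have := cdiffM (cdiff_cst a z) fc; rewrite mul0r add0r. Qed.

Lemma cdiffN f z c : cdiff f z c -> cdiff (fun w => - f w) z (- c).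
Proof.
move=> /(cdiffMl (-1)); rewrite mulN1r.
by under [X in cdiff X]funext => w do rewrite mulN1r.
Qed.

Lemma cdiffB f g z c d : cdiff f z c -> cdiff g z d ->
  cdiff (fun w => f w - g w) z (c - d).
Proof. by move=> fc /cdiffN; exact: cdiffD. Qed.

Lemma cdiffV z : z != 0 -> cdiff (fun w => w^-1) z (- z ^- 2).
Proof.
move=> z0 e e0; have n0 : 0 < normc z by rewrite normc_gt0.
set n := normc z in n0.
(* The remainder is |w - z|^2 / (n^2 |w|). With |w| > n / 2 it is at most e |w - z| as soon as |w -
   z| <= e n^3 / 2. *)
have r0 : 0 < e * n ^+ 3 / 2 by rewrite divr_gt0 // mulr_gt0 // exprn_gt0.
exists (Num.min (n / 2) (e * n ^+ 3 / 2)) => [|w].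
  by rewrite lt_min r0 divr_gt0.
rewrite lt_min => /andP[w1 w2].
have wn : n / 2 < normc w.
  have := normcD (z - w) w; rewrite subrK normcB_sym -/n; lra.
have w0 : w != 0 by rewrite -normc_gt0; apply: lt_trans wn; rewrite divr_gt0.
have -> : w^-1 - z^-1 - - z ^- 2 * (w - z) = (w - z) * ((w - z) / (z ^+ 2 * w)).
  by field; rewrite z0 w0.
rewrite normcM mulrC ler_wpM2r ?normc_ge0 //.
rewrite normcM normcV normcM normcX -/n ler_pdivrMr; last first.
  by rewrite mulr_gt0 ?exprn_gt0 // (lt_trans _ wn) // divr_gt0.
apply: (le_trans (ltW w2)).
have -> : e * n ^+ 3 / 2 = e * (n ^+ 2 * (n / 2)) by field.
by rewrite ler_wpM2l ?(ltW e0) // ler_wpM2l ?sqr_ge0 // ltW.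
Qed.

Lemma cdiff_near f g z c (r : R) : 0 < r ->
  (forall w, normc (w - z) < r -> f w = g w) -> cdiff f z c -> cdiff g z c.
Proof.
move=> r0 fg fc e e0; have [d d0 H] := fc e e0.
exists (Num.min d r) => [|w]; first by rewrite lt_min d0.
rewrite lt_min => /andP[wd wr]; rewrite -!fg //; first exact: H.
by rewrite subrr Normc.normc0.
Qed.

Lemma cexpD (z w : R[i]) : cexp (z + w) = cexp z * cexp w.
Proof.
by apply: eq_ReIm; rewrite ?cReM ?cImM /= cReD cImD expRD ?cosD ?sinD; ring.
Qed.

Lemma cexp0 : cexp 0 = 1 :> R[i].
Proof. by rewrite /cexp/= expR0 cos0 sin0 mulr1 mulr0. Qed.

Lemma normc_cexp (z : R[i]) : normc (cexp z) = expR (cRe z).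
Proof.
apply/eqP; rewrite -(@eqrXn2 _ 2%N) ?normc_ge0 ?expR_ge0 // normc_sqr /=.
by rewrite !exprMn -mulrDr cos2Dsin2 mulr1.
Qed.

Lemma cexp_neq0 (z : R[i]) : cexp z != 0.
Proof. by rewrite -normc_gt0 normc_cexp expR_gt0. Qed.

Lemma cdiff_cexp0 : cdiff (@cexp R) 0 1.
Proof.
move=> e e0.
(* The error terms [C1] to [C4] add up to 4 e1 N + 4 N^2, which is at most 8 e1 N because N < e1. *)
have [e1 e1_gt0 [e1_le1 e1e]] : exists2 e1 : R, 0 < e1 & e1 <= 1 /\ 8 * e1 <= e.
  exists (Num.min 1 (e / 8)); first by rewrite lt_min ltr01 divr_gt0.
  by split; [rewrite ge_min lexx|rewrite mulrC -ler_pdivlMr // ge_min lexx orbT].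
have [d1 d1_gt0 H1] := (is_deriveRP _ _ _).1 (is_derive_expR 0) e1 e1_gt0.
have [d2 d2_gt0 H2] := (is_deriveRP _ _ _).1 (is_derive_cos 0) e1 e1_gt0.
have [d3 d3_gt0 H3] := (is_deriveRP _ _ _).1 (is_derive_sin 0) e1 e1_gt0.
exists (Num.min e1 (Num.min d1 (Num.min d2 d3))).
  by rewrite !lt_min e1_gt0 d1_gt0 d2_gt0 d3_gt0.
case=> x y; rewrite subr0 cexp0 mul1r !lt_min => /and4P[we w1 w2 w3].
set N := normc (Complex x y) in w1 w2 w3 we *.
have xw : `|x| <= N := normc_Re (Complex x y).
have yw : `|y| <= N := normc_Im (Complex x y).
have := H1 x; rewrite expR0 mul1r subr0 => /(_ (le_lt_trans xw w1)) {}H1.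
have := H2 y; rewrite cos0 sin0 !(oppr0, mul0r, addr0) => /(_ (le_lt_trans yw w2)) {}H2.
have := H3 y; rewrite cos0 sin0 mul1r !subr0 => /(_ (le_lt_trans yw w3)) {}H3.
have N0 : 0 <= N by exact: normc_ge0.
have c1 : `|cos y| <= 1 by rewrite ler_norml cos_geN1 cos_le1.
have A1 : `|expR x - 1| <= 2 * N.
  have -> : expR x - 1 = (expR x - 1 - x) + x by ring.
  by apply: (le_trans (ler_normD _ _)); nra.
have A2 : `|sin y| <= 2 * N.
  have -> : sin y = (sin y - y) + y by ring.
  by apply: (le_trans (ler_normD _ _)); nra.
have A3 : `|1 + x| <= 2.
  by apply: (le_trans (ler_normD _ _)); rewrite normr1; lra.
apply: (le_trans (normc_le_ReIm _)); rewrite /= subr0.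
have -> : expR x * cos y - 1 - x = (expR x - 1 - x) * cos y + (1 + x) * (cos y - 1).
  by ring.
have -> : expR x * sin y - y = (expR x - 1) * sin y + (sin y - y) by ring.
have B1 := ler_normD ((expR x - 1 - x) * cos y) ((1 + x) * (cos y - 1)).
have B2 := ler_normD ((expR x - 1) * sin y) (sin y - y).
rewrite !normrM in B1 B2.
have C1 : `|expR x - 1 - x| * `|cos y| <= e1 * N.
  by rewrite -[leRHS]mulr1 ler_pM // (le_trans H1) // ler_wpM2l // ltW.
have C2 : `|1 + x| * `|cos y - 1| <= 2 * (e1 * N).
  by rewrite ler_pM // (le_trans H2) // ler_wpM2l // ltW.
have C3 : `|expR x - 1| * `|sin y| <= (2 * N) * (2 * N).
  by rewrite ler_pM.
have C4 : `|sin y - y| <= e1 * N by rewrite (le_trans H3) // ler_wpM2l // ltW.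
by nra.
Qed.

Lemma cdiff_cexp z : cdiff (@cexp R) z (cexp z).
Proof.
have H : cdiff (fun w => w - z) z 1.
  by have := cdiffB (cdiff_id z) (cdiff_cst z z); rewrite subr0.
have /(cdiff_comp H) : cdiff (@cexp R) (z - z) 1.
  by rewrite subrr; exact: cdiff_cexp0.
rewrite mulr1 => /(cdiffMl (cexp z)); rewrite mulr1.
by apply: (@cdiff_near _ _ _ _ 1) => // w _; rewrite /= -cexpD addrC subrK.
Qed.

End ComplexDiff.

(** * Goursat's theorem *)

Section NestedIntervals.
Context {R : realType}.

Lemma nested_intervals (a s : nat -> R) : (forall n, 0 <= s n) ->
  (forall n, a n <= a n.+1) -> (forall n, a n.+1 + s n.+1 <= a n + s n) ->
  exists x, forall n, a n <= x <= a n + s n.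
Proof.
move=> s0 ha hs.
have mono : {homo a : m n / (m <= n)%N >-> m <= n}.
  exact: homo_leq lexx le_trans ha.
have anti n m : (n <= m)%N -> a m + s m <= a n + s n.
  move=> nm; apply: (@homo_leq _ (fun k => a k + s k) (fun x y => y <= x)) nm => //.
  by move=> x y z /[swap]; exact: le_trans.
have ub n m : a m <= a n + s n.
  have [nm|/ltnW mn] := leqP n m; last by rewrite (le_trans (mono _ _ mn)) // lerDl.
  by rewrite (le_trans _ (anti _ _ nm)) // lerDl.
exists (sup (range a)) => n; apply/andP; split.
  apply: ub_le_sup; last by exists n.
  by exists (a 0%N + s 0%N) => _ [m _ <-].
apply: ge_sup; first by exists (a 0%N), 0%N.
by move=> _ [m _ <-].
Qed.

End NestedIntervals.

Section Goursat.
Context {R : realType}.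
Variables (H : R[i] -> R[i]) (P Q : R -> R -> R) (x0 y0 S T : R).
Hypothesis S0 : 0 <= S.
Hypothesis T0 : 0 <= T.
Let inrect x y := (x0 <= x <= x0 + S) && (y0 <= y <= y0 + T).
Hypothesis Hdiff : forall x y, inrect x y -> exists c, cdiff H (Complex x y) c.
Hypothesis dQ : forall x y, inrect x y ->
  is_derive y 1 (Q x) (cRe (H (Complex x y))).
Hypothesis dP : forall x y, inrect x y ->
  is_derive x 1 (P ^~ y) (cIm (H (Complex x y))).

(** [Q x] and [P ^~ y] are primitives along a single vertical or horizontal line. Their free
    constants cancel in second differences, so primitives on different lines need not be related. *)
Let Phi x y := Q x y - P x y.
(* The integral of Im (H dz) over the boundary of [a, a + s] x [b, b + t]. *)
Let bdry a b s t := Phi (a + s) (b + t) - Phi a (b + t) - Phi (a + s) b + Phi a b.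

(** The mean value theorem turns the two pairs of opposite sides into differences of Re H and Im H.
    By the Cauchy-Riemann equations the linear part of H contributes Re c * s * t to both, with
    opposite signs, so only the error e |w - z| of the expansion remains. *)
Lemma boundary_local (a b s t x y : R) (c : R[i]) (e d : R) :
  0 <= s -> 0 <= t -> x0 <= a -> a + s <= x0 + S -> y0 <= b -> b + t <= y0 + T ->
  a <= x <= a + s -> b <= y <= b + t -> s + t < d -> 0 < e ->
  (forall w, normc (w - Complex x y) < d ->
    normc (H w - H (Complex x y) - c * (w - Complex x y)) <=
      e * normc (w - Complex x y)) ->
  `|bdry a b s t| <= 2 * e * (s + t) ^+ 2.
Proof.
move=> s0 t0 ax as_ byy bt xa yb std e0 Hc.
have near u v : a <= u <= a + s -> b <= v <= b + t ->
  normc (H (Complex u v) - H (Complex x y) - c * Complex (u - x) (v - y))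
    <= e * (s + t).
  move=> ua vb.
  have E : Complex u v - Complex x y = Complex (u - x) (v - y) by [].
  have L : normc (Complex (u - x) (v - y)) <= s + t.
    apply: (le_trans (normc_le_ReIm _)) => /=.
    by apply: lerD; rewrite ler_norml; apply/andP; split; lra.
  have := Hc (Complex u v); rewrite E => /(_ (le_lt_trans L std)) /le_trans; apply.
  by rewrite ler_wpM2l // ltW.
have in_ v : a <= a + s -> b <= v <= b + t -> inrect (a + s) v.
  by move=> ? /andP[? ?]; apply/andP; split; apply/andP; split; lra.
have in_0 v : b <= v <= b + t -> inrect a v.
  by move=> /andP[? ?]; apply/andP; split; apply/andP; split; lra.
have in1_ u : a <= u <= a + s -> inrect u (b + t).
  by move=> /andP[? ?]; apply/andP; split; apply/andP; split; lra.
have in1_0 u : a <= u <= a + s -> inrect u b.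
  by move=> /andP[? ?]; apply/andP; split; apply/andP; split; lra.
have bb : b <= b + t by rewrite lerDl.
have aa : a <= a + s by rewrite lerDl.
have [eta eta_in HQ] := @MVT_le R (Q (a + s) - Q a)
  (fun v => cRe (H (Complex (a + s) v)) - cRe (H (Complex a v))) b (b + t) bb
  (fun v hv => is_deriveB (dQ (in_ _ aa hv)) (dQ (in_0 _ hv))).
have [xi xi_in HP] := @MVT_le R (P ^~ (b + t) - P ^~ b)
  (fun u => cIm (H (Complex u (b + t))) - cIm (H (Complex u b))) a (a + s) aa
  (fun u hu => is_deriveB (dP (in1_ _ hu)) (dP (in1_0 _ hu))).
have -> : bdry a b s t = (Q (a + s) - Q a) (b + t) - (Q (a + s) - Q a) b -
    ((P ^~ (b + t) - P ^~ b) (a + s) - (P ^~ (b + t) - P ^~ b) a).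
  by rewrite /bdry /Phi !fctE; ring.
rewrite {}HQ {}HP.
have a_in : a <= a <= a + s by rewrite lexx.
have as_in : a <= a + s <= a + s by rewrite lexx andbT.
have b_in : b <= b <= b + t by rewrite lexx.
have bt_in : b <= b + t <= b + t by rewrite lexx andbT.
have N1 := near _ _ as_in eta_in; have N2 := near _ _ a_in eta_in.
have N3 := near _ _ xi_in bt_in; have N4 := near _ _ xi_in b_in.
move: N1 N2 N3 N4.
move=> /(le_trans (normc_Re _)) N1 /(le_trans (normc_Re _)) N2.
move=> /(le_trans (normc_Im _)) N3 /(le_trans (normc_Im _)) N4.
rewrite !cReD !cReN cReM /= in N1; rewrite !cReD !cReN cReM /= in N2.
rewrite !cImD !cImN cImM /= in N3; rewrite !cImD !cImN cImM /= in N4.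
move: N1 N2 N3 N4; rewrite !(ler_norml _ (e * _)).
move=> /andP[N1 N1'] /andP[N2 N2'] /andP[N3 N3'] /andP[N4 N4'].
set q1 := cRe (H (Complex (a + s) eta)) in N1 N1' *.
set q0 := cRe (H (Complex a eta)) in N2 N2' *.
set p1 := cIm (H (Complex xi (b + t))) in N3 N3' *.
set p0 := cIm (H (Complex xi b)) in N4 N4' *.
have Dq : `|q1 - q0 - cRe c * s| <= 2 * (e * (s + t)).
  by rewrite ler_norml; apply/andP; split; lra.
have Dp : `|p1 - p0 - cRe c * t| <= 2 * (e * (s + t)).
  by rewrite ler_norml; apply/andP; split; lra.
have -> : (q1 - q0) * (b + t - b) - (p1 - p0) * (a + s - a) =
  (q1 - q0 - cRe c * s) * t - (p1 - p0 - cRe c * t) * s by ring.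
apply: (le_trans (ler_normB _ _)); rewrite !normrM (ger0_norm s0) (ger0_norm t0).
have -> : 2 * e * (s + t) ^+ 2 =
  2 * (e * (s + t)) * t + 2 * (e * (s + t)) * s by ring.
by apply: lerD; rewrite ler_wpM2r.
Qed.

(** The terms of the four quarters add up to that of the rectangle, so one of them carries at least
    a fourth of it. The bounds on its corner are all that nesting requires. *)
Lemma boundary_quarter (a b s t : R) : 0 <= s -> 0 <= t ->
  exists ab : R * R,
  [/\ a <= ab.1 <= a + s / 2, b <= ab.2 <= b + t / 2 &
   `|bdry a b s t| <= 4 * `|bdry ab.1 ab.2 (s / 2) (t / 2)|].
Proof.
move=> s0 t0.
have sE : a + s / 2 + s / 2 = a + s by field.
have tE : b + t / 2 + t / 2 = b + t by field.
set B := bdry a b s t.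
set B1 := bdry a b (s / 2) (t / 2); set B2 := bdry (a + s / 2) b (s / 2) (t / 2).
set B3 := bdry a (b + t / 2) (s / 2) (t / 2).
set B4 := bdry (a + s / 2) (b + t / 2) (s / 2) (t / 2).
have BE : B = B1 + B2 + B3 + B4.
  by rewrite /B /B1 /B2 /B3 /B4 /bdry sE tE; ring.
have BL : `|B| <= `|B1| + `|B2| + `|B3| + `|B4|.
  rewrite BE; apply: (le_trans (ler_normD _ _)); rewrite lerD2r.
  by apply: (le_trans (ler_normD _ _)); rewrite lerD2r ler_normD.
have [le1|lt1] := leP `|B| (4 * `|B1|).
  by exists (a, b); split => //=; rewrite lexx lerDl divr_ge0.
have [le2|lt2] := leP `|B| (4 * `|B2|).
  by exists (a + s / 2, b); split => //=; rewrite lexx lerDl divr_ge0.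
have [le3|lt3] := leP `|B| (4 * `|B3|).
  by exists (a, b + t / 2); split => //=; rewrite lexx lerDl divr_ge0.
exists (a + s / 2, b + t / 2); split => //=; rewrite ?lexx ?lerDl ?divr_ge0 //.
by rewrite -/B4; lra.
Qed.

Lemma goursat : Phi (x0 + S) (y0 + T) - Phi x0 (y0 + T) -
  Phi (x0 + S) y0 + Phi x0 y0 = 0.
Proof.
rewrite -/(bdry x0 y0 S T); apply/eqP; apply/negPn/negP => B0.
pose q (st : R * R) (ab : R * R) (ab' : R * R) :=
  [/\ ab.1 <= ab'.1 <= ab.1 + st.1 / 2, ab.2 <= ab'.2 <= ab.2 + st.2 / 2 &
   `|bdry ab.1 ab.2 st.1 st.2| <= 4 * `|bdry ab'.1 ab'.2 (st.1 / 2) (st.2 / 2)|].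
(* Choice needs a total function, so the sign conditions are moved under the existential. *)
have /choice[next Hnext] (p : (R * R) * (R * R)) : exists ab' : R * R,
    0 <= p.1.1 -> 0 <= p.1.2 -> q p.1 p.2 ab'.
  move: p => [[s t] [a b]] /=.
  have [s0|s0] := boolP (0 <= s); last by exists (0, 0).
  have [t0|t0] := boolP (0 <= t); last by exists (0, 0).
  by have [ab' H'] := boundary_quarter a b s0 t0; exists ab'.
pose st n := (S / 2 ^+ n, T / 2 ^+ n).
pose fix ab n : R * R := if n is m.+1 then next (st m, ab m) else (x0, y0).
have p2 n : 0 < 2 ^+ n :> R by rewrite exprn_gt0.
have stS n : st n.+1 = ((st n).1 / 2, (st n).2 / 2).
  by rewrite /st /= exprS; congr (_, _); field; rewrite gt_eqF.
have st1S n : (st n.+1).1 = (st n).1 / 2 by rewrite stS.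
have st2S n : (st n.+1).2 = (st n).2 / 2 by rewrite stS.
have st10 n : 0 <= (st n).1 by rewrite divr_ge0 // ltW.
have st20 n : 0 <= (st n).2 by rewrite divr_ge0 // ltW.
have step n : q (st n) (ab n) (ab n.+1) by exact: (Hnext (st n, ab n) (st10 n) (st20 n)).
have [x Hx] : exists x, forall n, (ab n).1 <= x <= (ab n).1 + (st n).1.
  apply: nested_intervals => // n; have [/andP[? ?] _ _] := step n; rewrite ?st1S; lra.
have [y Hy] : exists y, forall n, (ab n).2 <= y <= (ab n).2 + (st n).2.
  apply: nested_intervals => // n; have [_ /andP[? ?] _] := step n; rewrite ?st2S; lra.
have low n : `|bdry x0 y0 S T| <= 4 ^+ n * `|bdry (ab n).1 (ab n).2 (st n).1 (st n).2|.
  elim: n => [|n IH]; first by rewrite expr0 mul1r /st /= !divr1.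
  apply: (le_trans IH); rewrite exprSr -mulrA ler_wpM2l ?exprn_ge0 //.
  by have [_ _] := step n; rewrite st1S st2S.
have ab_in n : [/\ x0 <= (ab n).1, (ab n).1 + (st n).1 <= x0 + S,
    y0 <= (ab n).2 & (ab n).2 + (st n).2 <= y0 + T].
  elim: n => [|n [h1 h2 h3 h4]]; first by rewrite /st /= !divr1.
  have [/andP[? ?] /andP[? ?] _] := step n.
  by rewrite st1S st2S; split; lra.
have xy_in : inrect x y by have := Hx 0%N; have := Hy 0%N; rewrite /st /= !divr1 /inrect => -> ->.
have [c Hc] := Hdiff xy_in.
(* The contradiction will be |B| <= 2 e (S + T)^2 < 2 e K = |B|, with B the boundary term of the
   whole rectangle. The summand 1 makes the inequality strict and covers degenerate rectangles. *)
pose K := (S + T) ^+ 2 + 1.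
have K0 : 0 < K by rewrite ltr_wpDl // sqr_ge0.
pose e := `|bdry x0 y0 S T| / (2 * K).
have e0 : 0 < e by rewrite divr_gt0 ?normr_gt0 // mulr_gt0.
have [d d0 Hd] := Hc e e0.
have [n Hn] : exists n, (st n).1 + (st n).2 < d.
  pose m := Num.truncn ((S + T) / d).
  have Hm : (S + T) / d < m.+1%:R by exact: truncnS_gt.
  exists m.+1; rewrite /st /= -mulrDl ltr_pdivrMr // mulrC -ltr_pdivrMr //.
  apply: (lt_trans Hm); rewrite -natrX ltr_nat.
  by apply: ltn_expl.
have [h1 h2 h3 h4] := ab_in n.
have L1 := boundary_local (st10 n) (st20 n) h1 h2 h3 h4 (Hx n) (Hy n) Hn e0 Hd.
have L2 := low n.
(* The factor 4^n lost by passing to quarters is exactly regained from the square of the side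
   lengths. *)
have E : 4 ^+ n * (2 * e * ((st n).1 + (st n).2) ^+ 2) = 2 * e * (S + T) ^+ 2.
  rewrite /st /= -mulrDl expr_div_n -exprM mulnC exprM.
  have -> : 2 ^+ 2 = 4 :> R by ring.
  by field; rewrite expf_neq0.
have : `|bdry x0 y0 S T| <= 2 * e * (S + T) ^+ 2.
  by rewrite -E (le_trans L2) // ler_wpM2l // exprn_ge0.
have : 2 * e * K = `|bdry x0 y0 S T|.
  by rewrite /e; field; rewrite gt_eqF.
have : 0 < `|bdry x0 y0 S T| by rewrite normr_gt0.
rewrite /K; nra.
Qed.

End Goursat.

(** * A minimum principle on circles *)

Section CircleMin.
Context {R : realType}.
Implicit Types (G h : R[i] -> R[i]).

Lemma cdiff_line_cts (f : R[i] -> R[i]) (p : R -> R[i]) (k : R) (t : R) c :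
  0 < k -> (forall u v, normc (p u - p v) <= k * `|u - v|) -> cdiff f (p t) c ->
  {for t, continuous (fun u => cRe (f (p u)))} /\
  {for t, continuous (fun u => cIm (f (p u)))}.
Proof.
move=> k0 pk fc.
have H (e : R) : 0 < e -> exists2 d : R, 0 < d &
    forall u, `|u - t| < d -> normc (f (p u) - f (p t)) < e.
  move=> e0; have [d d0 Hd] := cdiff_cont fc e0.
  exists (d / k) => [|u ut]; first by rewrite divr_gt0.
  by apply: Hd; apply: (le_lt_trans (pk _ _)); rewrite mulrC -ltr_pdivlMr.
split; apply/continuousRP => e /H[d d0 Hd]; exists d => // u /Hd; apply: le_lt_trans.
  by rewrite -cReN -cReD normc_Re.
by rewrite -cImN -cImD normc_Im.
Qed.

Lemma min_lipschitz (a x y : R) : `|Num.min x a - Num.min y a| <= `|x - y|.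
Proof.
rewrite /Num.min; case: ltP => xa; case: ltP => ya //; rewrite ?subrr ?normr0 //.
  by rewrite !ltr0_norm; lra.
by rewrite !ger0_norm; lra.
Qed.

Lemma cexp_2pi (x : R) : cexp (Complex x (2 * pi)) = cexp (Complex x 0).
Proof. by rewrite /cexp /= mulr_natl cos2pi sin2pi cos0 sin0. Qed.

(* In the coordinate log z circles become vertical segments of length 2 pi; the
   horizontal sides of a rectangle of that height cancel by periodicity. *)
Lemma half_plane_mean G (b : R) (x : R) : x <= b ->
  (forall w, cRe w <= b -> exists c, cdiff (G \o @cexp R) w c) ->
  (forall w, cRe w = b -> 0 <= cRe (G (cexp w))) ->
  exists y, 0 <= cRe (G (cexp (Complex x y))).
Proof.
move=> xb dG Gb; pose H := G \o @cexp R.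
have pi0 : 0 < 2 * pi :> R by rewrite mulr_gt0 // pi_gt0.
have vert (u : R) (v : R) : u <= b -> {for v, continuous (fun v => cRe (H (Complex u v)))}.
  move=> ub; have [c Hc] := dG (Complex u v) ub.
  have [] // := @cdiff_line_cts H (Complex u) 1 v c ltr01 _ Hc.
  move=> v1 v2; rewrite mul1r.
  by rewrite (_ : Complex u v1 - Complex u v2 = Complex 0 (v1 - v2)) /=;
    rewrite ?(expr0n, add0r) ?sqrtr_sqr //; congr Complex; rewrite subrr.
have horz (v u : R) : {for u, continuous (fun u => cIm (H (Complex (Num.min u b) v)))}.
  have [|c Hc] := dG (Complex (Num.min u b) v); first by rewrite ge_min lexx orbT.
  have [] // := @cdiff_line_cts H (fun u => Complex (Num.min u b) v) 1 u c ltr01 _ Hc.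
  move=> v1 v2; rewrite mul1r.
  apply: (le_trans (normc_le_ReIm _)); rewrite /= subrr normr0 addr0.
  exact: min_lipschitz.
have /choice[Q HQ] (u : R) : exists F : R -> R, u <= b ->
    forall v : R, -1 < v -> is_derive v 1 F (cRe (H (Complex u v))).
  have [ub|] := boolP (u <= b); last by exists idfun.
  by have [F HF] := @primitive_exists R (fun v : R => cRe (H (Complex u v))) (-1)
    (fun v => vert u v ub); exists F.
(* The clamp Num.min u b makes the integrand continuous on the whole line. *)
have /choice[I HI] (f : R -> R) : exists F : R -> R, continuous f ->
    forall u : R, x - 1 < u -> is_derive u 1 F (f u).
  have [fc|fc] := pselect (continuous f); last by exists idfun.
  by have [F HF] := primitive_exists (x - 1) fc; exists F.
pose P u v := I (fun u => cIm (H (Complex (Num.min u b) v))) u.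
have HP (u v : R) : x - 1 < u -> u <= b ->
    is_derive u 1 (P ^~ v) (cIm (H (Complex u v))).
  move=> xu ub; have := HI _ (horz v) u xu.
  by rewrite (min_idPl ub).
have S0 : 0 <= b - x by lra.
(* [I] is a function of the integrand, so equal integrands at heights 0 and 2 pi receive the same
   primitive, constant included. *)
have per u : P u (2 * pi) = P u 0.
  by rewrite /P; congr (I _ u); apply/funext => u'; rewrite /H /= cexp_2pi.
have E : Q b (2 * pi) - Q b 0 = Q x (2 * pi) - Q x 0.
  have := @goursat R H P Q x 0 (b - x) (2 * pi) S0 (ltW pi0).
  rewrite add0r [x + _]addrC subrK !per => gour.
  apply/eqP; rewrite -subr_eq0; apply/eqP; rewrite -[RHS]gour; first by ring.
  - by move=> u v /andP[/andP[_ ub] _]; apply: dG.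
  - by move=> u v /andP[/andP[_ ub] /andP[v0 _]]; apply: HQ => //; lra.
  - by move=> u v /andP[/andP[xu ub] _]; apply: HP => //; lra.
have dQ (u : R) : u <= b -> forall v : R, 0 <= v <= 2 * pi ->
    is_derive v 1 (Q u) (cRe (H (Complex u v))).
  by move=> ub v /andP[v0 _]; apply: HQ => //; lra.
(* Both increments of [Q] equal 2 pi times a value of the real part on the respective circle; on the
   outer circle that value is nonnegative by [Gb]. *)
have [v1 _ E1] := MVT_le (ltW pi0) (dQ b (lexx b)).
have [v2 _ E2] := MVT_le (ltW pi0) (dQ x xb).
exists v2; rewrite -(pmulr_lge0 _ pi0).
move: E2; rewrite subr0 -E E1 subr0 /= => <-.
by rewrite mulr_ge0 ?(ltW pi0) //; exact: Gb.
Qed.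

(** If Re G were negative at 0, by continuity it would be negative on a whole small circle, against
    [half_plane_mean]. Differentiability at 0 is not asked for, because 0 is not a value of
    [cexp]. *)
Lemma circle_min G (rho : R) : 0 < rho ->
  (forall w, w != 0 -> normc w <= rho -> exists c, cdiff G w c) ->
  {for 0, continuous G} ->
  (forall w, normc w = rho -> 0 <= cRe (G w)) -> 0 <= cRe (G 0).
Proof.
move=> rho0 dG cG Gb; have [//|G0] := leP 0 (cRe (G 0)).
have [d d0 Hd] : exists2 d : R, 0 < d &
    forall w, normc (w - 0) < d -> normc (G w - G 0) < - cRe (G 0).
  by apply: (continuousCP _ _).1 => //; lra.
pose x := Num.min (ln rho) (ln (d / 2)).
have xb : x <= ln rho by rewrite ge_min lexx.
have [w|w wb|y Gy] := @half_plane_mean G (ln rho) x xb.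
- rewrite -ler_expR lnK // -normc_cexp => /(dG _ (cexp_neq0 _))[c Hc].
  by exists (c * cexp w); apply: cdiff_comp Hc; exact: cdiff_cexp.
- by apply: Gb; rewrite normc_cexp wb lnK.
have : normc (cexp (Complex x y) - 0) < d.
  rewrite subr0 normc_cexp /= (@le_lt_trans _ _ (d / 2)) //; last by lra.
  by rewrite -[leRHS]lnK ?posrE ?divr_gt0 // ler_expR ge_min lexx orbT.
move=> /Hd /(le_lt_trans (normc_Re _)); rewrite cReD cReN ltr_norml => /andP[_].
by move=> ?; exfalso; lra.
Qed.

End CircleMin.

(** * Growth of holomorphic functions on the disk *)

Section PositiveRealPart.
Context {R : realType}.
Implicit Types (h : R[i] -> R[i]).

(** With u = Re h, the mean of 2 u (1 - cos) over the circle of radius rho is 2 u(0) - rho Re c, and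
    the integrand is nonnegative. [G] is a function whose real part is this integrand on the circle
    and this mean at 0, so [circle_min] replaces the integral. *)
Lemma positive_re_deriv0 h (rho r : R) c : 0 < rho -> rho < r ->
  (forall w, normc w < r -> exists c, cdiff h w c) ->
  (forall w, normc w < r -> 0 <= cRe (h w)) -> cdiff h 0 c ->
  rho * cRe c <= 2 * cRe (h 0).
Proof.
move=> rho0 rhor dh h0 hc.
have rhoC : rho%:C != 0 by rewrite -normc_eq0 normcR normr_eq0 gt_eqF.
(* The conjugate makes the two terms containing h(0) cancel in the real part on the circle. *)
pose hbar := Complex (cRe (h 0)) (- cIm (h 0)).
pose A w := 2 * h w - rho%:C^-1 * w * (h w + hbar).
pose q w := if w == 0 then c else (h w - h 0) * w^-1.
(* On the circle normc w = rho, the real part of A w - rho * q w is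
   2 * cRe (h w) * (1 - cRe w / rho). *)
pose G w := A w - rho%:C * q w.
have dA w : normc w < r -> exists c, cdiff A w c.
  move=> /dh[c' hc']; eexists; apply: cdiffB; first exact: cdiffMl hc'.
  apply: cdiffM; first exact: cdiffMl (cdiff_id _).
  exact: cdiffD hc' (cdiff_cst _ _).
have GE0 : cRe (G 0) = 2 * cRe (h 0) - rho * cRe c.
  rewrite /G /A /q eqxx mulr0 mul0r subr0 cReD cReN !cReM /=; ring.
suff : 0 <= cRe (G 0) by rewrite GE0; lra.
apply: (@circle_min R G rho) => // [w w0 wrho||w wrho].
- have wr := le_lt_trans wrho rhor.
  have [a Ha] := dA w wr; have [b Hb] := dh w wr.
  have [d Hd] : exists d, cdiff q w d.
    eexists; apply: (@cdiff_near _ (fun v => (h v - h 0) * v^-1) _ _ _ (normc w)).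
    - by rewrite normc_gt0.
    - move=> v vw; rewrite /q; case: eqP => // v0.
      by move: vw; rewrite v0 sub0r normcN ltxx.
    - by apply: cdiffM (cdiffV w0); apply: cdiffB Hb (cdiff_cst _ _).
  by eexists; apply: cdiffB Ha (cdiffMl _ Hd).
- apply/continuousCP => e e0.
  have [a Ha] : exists a, cdiff A 0 a by apply: dA; rewrite Normc.normc0 (lt_trans rho0).
  have e20 : 0 < e / 2 by lra.
  have [d1 d10 H1] := cdiff_cont Ha e20.
  have e30 : 0 < e / 2 / (rho * 2) by rewrite divr_gt0 // mulr_gt0.
  have [d2 d20 H2] := hc _ e30.
  exists (Num.min d1 d2) => [|w]; first by rewrite lt_min d10.
  rewrite lt_min => /andP[/H1 h1 /H2 h2].
  have -> : G w - G 0 = (A w - A 0) + - (rho%:C * (q w - q 0)) by rewrite /G; ring.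
  apply: (le_lt_trans (normcD _ _)); rewrite normcN normcM normcR gtr0_norm //.
  have : rho * normc (q w - q 0) <= e / 4.
    have -> : e / 4 = rho * (e / 2 / (rho * 2)) by field; rewrite gt_eqF.
    rewrite ler_wpM2l ?(ltW rho0) // /q eqxx; case: eqP => [_|/eqP w0].
      by rewrite subrr Normc.normc0 ltW.
    have -> : (h w - h 0) * w^-1 - c = (h w - h 0 - c * (w - 0)) * w^-1.
      by field.
    rewrite normcM normcV ler_pdivrMr ?normc_gt0 //.
    by move: h2; rewrite !subr0.
  by lra.
have w0 : w != 0 by rewrite -normc_gt0 wrho.
rewrite /G /A /q (negPf w0).
have [p [s [ps eE iE]]] : exists p s : R, [/\ p ^+ 2 + s ^+ 2 = 1,
    rho%:C^-1 * w = Complex p s & rho%:C * w^-1 = Complex p (- s)].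
  exists (cRe w / rho), (cIm w / rho).
  have E : cRe w ^+ 2 + cIm w ^+ 2 = rho ^+ 2 by rewrite -normc_sqr wrho.
  have E1 : (cRe w / rho) ^+ 2 + (cIm w / rho) ^+ 2 = 1.
    by rewrite !expr_div_n -mulrDl E divff // expf_neq0 // gt_eqF.
  have E2 : rho%:C^-1 * w = Complex (cRe w / rho) (cIm w / rho).
    apply: (mulfI rhoC); rewrite mulrA divff // mul1r.
    by apply: eq_ReIm; rewrite ?cReM ?cImM /=; field; rewrite gt_eqF.
  split=> //.
  have e0 : rho%:C^-1 * w != 0 by rewrite mulf_neq0 // invr_neq0.
  have -> : rho%:C * w^-1 = (rho%:C^-1 * w)^-1 by rewrite invfM invrK.
  apply: (mulfI e0); rewrite divff // E2.
  apply: eq_ReIm; first by rewrite cReM /= -E1; ring.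
  by rewrite cImM /=; ring.
have -> : 2 * h w - rho%:C^-1 * w * (h w + hbar) -
    rho%:C * ((h w - h 0) * w^-1) =
  2 * h w - Complex p s * (h w + hbar) - Complex p (- s) * (h w - h 0).
  by rewrite -eE -iE; ring.
have -> : cRe (2 * h w - Complex p s * (h w + hbar) -
    Complex p (- s) * (h w - h 0)) = 2 * cRe (h w) * (1 - p).
  by rewrite /hbar !(cReD, cReN, cReM, cImD, cImN) /=; ring.
rewrite mulr_ge0 //; last by nra.
by rewrite mulr_ge0 // h0 // wrho.
Qed.

(** Precomposition with a rotation about z makes the derivative real and positive, so that its real
    part is its modulus; then rho tends to r. *)
Lemma positive_re_deriv h z (r : R) c : 0 < r ->
  (forall w, normc (w - z) < r -> exists c, cdiff h w c) ->
  (forall w, normc (w - z) < r -> 0 <= cRe (h w)) -> cdiff h z c ->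
  r * normc c <= 2 * cRe (h z).
Proof.
move=> r0 dh h0 hc; have u0 : 0 <= cRe (h z) by rewrite h0 // subrr Normc.normc0.
have [->|c0] := eqVneq c 0; first by rewrite Normc.normc0 mulr0 mulr_ge0.
have n0 : 0 < normc c by rewrite normc_gt0.
pose om := (normc c)%:C / c.
have om1 : normc om = 1.
  by rewrite normcM normcV normcR gtr0_norm // divff // gt_eqF.
have omc : c * om = (normc c)%:C by rewrite mulrC divfK.
have lin w : cdiff (fun w => z + om * w) w om.
  by have := cdiffD (cdiff_cst z w) (cdiffMl om (cdiff_id w)); rewrite add0r mulr1.
have linE w : normc (z + om * w - z) = normc w.
  by rewrite addrC addKr normcM om1 mul1r.
have key rho : 0 < rho -> rho < r -> rho * normc c <= 2 * cRe (h z).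
  move=> rho0 rhor.
  have := @positive_re_deriv0 (h \o (fun w => z + om * w)) rho r (c * om) rho0 rhor.
  rewrite /= mulr0 addr0 omc; apply.
  - move=> w wr; have [c' Hc'] := dh (z + om * w) ltac:(by rewrite linE).
    by exists (c' * om); apply: cdiff_comp (lin w) Hc'.
  - by move=> w wr; apply: h0; rewrite linE.
  - by rewrite -omc; apply: cdiff_comp (lin 0) _; rewrite mulr0 addr0.
have [//|lt] := leP (r * normc c) (2 * cRe (h z)).
(* The midpoint between the radius at which the bound is an equality and r; the bound already fails
   there. *)
pose rho := (2 * cRe (h z) / normc c + r) / 2.
have rhoE : rho * normc c = cRe (h z) + r * normc c / 2.
  by rewrite /rho; field; rewrite gt_eqF.
have rlt : 2 * cRe (h z) / normc c < r by rewrite ltr_pdivrMr.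
have rge : 0 <= 2 * cRe (h z) / normc c by rewrite divr_ge0 // ?mulr_ge0 // ltW.
by have := key rho ltac:(rewrite /rho; lra) ltac:(rewrite /rho; lra); rewrite rhoE; lra.
Qed.

End PositiveRealPart.

(** * The derivative at 0 when exp h has bounded spherical derivative *)

Section LandauGrowth.
Context {R : realType}.

Lemma is_derive_ray (h : R[i] -> R[i]) (b c : R[i]) (t : R) :
  cdiff h (t%:C * b) c ->
  is_derive t 1 (fun t : R => cRe (h (t%:C * b))) (cRe (c * b)).
Proof.
move=> hc; apply/is_deriveRP => e e0.
have b0 := normc_ge0 b; have b1 : 0 < normc b + 1 by lra.
have [d d0 Hd] := hc (e / (normc b + 1)) ltac:(by rewrite divr_gt0).
exists (d / (normc b + 1)) => [|s st]; first by rewrite divr_gt0.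
have E : s%:C * b - t%:C * b = (s - t)%:C * b by rewrite rmorphB mulrBl.
have NE : normc ((s - t)%:C * b) = `|s - t| * normc b by rewrite normcM normcR.
have L : normc ((s - t)%:C * b) <= `|s - t| * (normc b + 1).
  by rewrite NE ler_wpM2l // lerDl.
have := Hd (s%:C * b); rewrite E.
move=> /(_ (le_lt_trans L _)) -/(_ ltac:(by rewrite -ltr_pdivlMr)) H.
have -> : cRe (h (s%:C * b)) - cRe (h (t%:C * b)) - cRe (c * b) * (s - t) =
  cRe (h (s%:C * b) - h (t%:C * b) - c * ((s - t)%:C * b)).
  by rewrite !(cReD, cReN, cReM, cImM) /=; ring.
apply: (le_trans (normc_Re _)); apply: (le_trans H).
apply: (le_trans (ler_wpM2l _ L)); first by rewrite ltW // divr_gt0.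
by rewrite mulrCA divfK ?gt_eqF // mulrC.
Qed.

Variables (h : R[i] -> R[i]) (K : R).
Hypothesis dh : forall w, normc w < 1 -> exists c, cdiff h w c.
Hypothesis hK : forall w c, normc w < 1 / 2 -> cdiff h w c ->
  normc c * expR (cRe (h w)) <= K * (1 + expR (cRe (h w)) ^+ 2).

Lemma growth_const_ge0 : 0 <= K.
Proof.
have [c hc] := dh (w := 0) ltac:(by rewrite Normc.normc0).
have := hK (w := 0) ltac:(by rewrite Normc.normc0 divr_gt0) hc.
have := normc_ge0 c; have := expR_gt0 (cRe (h 0)).
set E := expR _; move=> E0 c0 H.
have E2 : 0 < 1 + E ^+ 2 by rewrite ltr_wpDr // sqr_ge0.
by rewrite -(pmulr_lge0 _ E2) (le_trans _ H) // mulr_ge0 // ltW.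
Qed.

(** The derivative of 1 / (1 + e^v) is -v' e^v / (1 + e^v)^2, and [hK] bounds |v'| e^v by K |z| (1 +
    e^(2v)), which is at most K |z| (1 + e^v)^2. *)
Lemma ray_lipschitz (z : R[i]) (t : R) : normc z < 1 / 2 -> 0 <= t <= 1 ->
  (1 + expR (cRe (h z)))^-1 - (1 + expR (cRe (h (t%:C * z))))^-1 <=
  K * normc z * (1 - t).
Proof.
move=> z2 /andP[t0 t1].
pose v (s : R) := cRe (h (s%:C * z)).
have inball (s : R) : t <= s <= 1 -> normc (s%:C * z) < 1 / 2.
  move=> /andP[ts s1]; rewrite normcM normcR ger0_norm ?(le_trans t0) //.
  by apply: le_lt_trans z2; rewrite ler_piMl // normc_ge0.
have /choice[c Hc] (w : R[i]) : exists c, normc w < 1 / 2 -> cdiff h w c.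
  have [w2|] := boolP (normc w < 1 / 2); last by exists 0.
  by have [|c hc] := dh (w := w); [lra|exists c].
have dG (s : R) : t <= s <= 1 -> is_derive s 1 (fun s => (1 + expR (v s))^-1)
    (- (1 + expR (v s)) ^- 2 * (cRe (c (s%:C * z) * z) * expR (v s))).
  move=> ts; have dv := is_derive_ray (Hc _ (inball s ts)).
  have dE : is_derive s 1 (fun s => 1 + expR (v s))
      (0 + cRe (c (s%:C * z) * z) * expR (v s)).
    apply: is_deriveD; rewrite mulrC.
    exact: (@is_derive1_comp _ expR v).
  rewrite add0r in dE.
  by apply: is_deriveV dE; rewrite gt_eqF // ltr_wpDr ?expR_ge0.
have [s ts] := MVT_le t1 dG; rewrite /v mul1r => ->.
rewrite ler_wpM2r ?subr_ge0 //.
have := hK (inball s ts) (Hc _ (inball s ts)); have K0 := growth_const_ge0.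
have := expR_gt0 (cRe (h (s%:C * z))); set E := expR _; set d := c _ => E0 dE.
have E1 : 0 < (1 + E) ^+ 2 by rewrite exprn_gt0 // ltr_wpDr // ltW.
rewrite mulNr -mulrN mulrC ler_pdivrMr //.
have := normc_Re (d * z); rewrite normcM ler_norml => /andP[+ _] => dz.
have z0 := normc_ge0 z; have d0 := normc_ge0 d.
have := ler_wpM2r z0 dE; have := ler_wpM2r (ltW E0) dz.
have : 0 <= K * normc z * E by rewrite !mulr_ge0 // ltW.
nra.
Qed.

(* With v s the value of the real part at s z, the Borel-Caratheodory bound makes
   v s / (t1 - s) ^ 2 nondecreasing. *)
Lemma ray_decay (z : R[i]) (t1 t : R) : 0 <= t -> t < t1 -> t1 <= 1 ->
  normc z < 1 -> 0 < normc z ->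
  (forall w, normc w < t1 * normc z -> 0 <= cRe (h w)) ->
  (t1 - t) ^+ 2 * cRe (h 0) <= t1 ^+ 2 * cRe (h (t%:C * z)).
Proof.
move=> t0 tt1 t11 z1 z0 pos.
pose v (s : R) := cRe (h (s%:C * z)).
have sz (s : R) : 0 <= s -> normc (s%:C * z) = s * normc z.
  by move=> s0; rewrite normcM normcR ger0_norm.
have /choice[c Hc] (w : R[i]) : exists c, normc w < 1 -> cdiff h w c.
  have [w2|] := boolP (normc w < 1); last by exists 0.
  by have [c hc] := dh w2; exists c.
have inball (s : R) : 0 <= s <= t -> normc (s%:C * z) < 1.
  by move=> /andP[s0 st]; rewrite sz //; nra.
pose W (s : R) := v s * ((t1 - s) ^+ 2)^-1.
pose dW (s : R) := v s * (- ((t1 - s) ^+ 2) ^- 2 * (- (2 * (t1 - s))))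
  + ((t1 - s) ^+ 2)^-1 * cRe (c (s%:C * z) * z).
have HW (s : R) : 0 <= s <= t -> is_derive s 1 W (dW s).
  move=> st; have dv := is_derive_ray (Hc _ (inball s st)).
  have dl : is_derive s 1 (fun s : R => t1 - s) (0 - 1) by apply: is_deriveB.
  have dq : is_derive s 1 (fun s : R => (t1 - s) ^+ 2) (- (2 * (t1 - s))).
    have := is_deriveM dl dl.
    rewrite /GRing.scale /= => H; apply: (is_derive_eq H); ring.
  have q0 : (t1 - s) ^+ 2 != 0 by rewrite expf_neq0 // subr_eq0 gt_eqF //; lra.
  have H := is_deriveM dv (@is_deriveV R (fun s => (t1 - s) ^+ 2) s _ 1 q0 dq).
  by apply: (is_derive_eq H); rewrite /dW /GRing.scale /=.
have [s st] := MVT_le t0 HW; rewrite subr0 => E.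
have dW0 : 0 <= dW s.
  have s1 : 0 < t1 - s by lra.
  have s0 : 0 <= s by lra.
  have := @positive_re_deriv R h (s%:C * z) ((t1 - s) * normc z) (c (s%:C * z)).
  (* The disk about s z of radius (t1 - s) |z| stays where the real part is nonnegative;
     Borel-Caratheodory on it gives (t1 - s) |v'| <= 2 v, which is the sign of [dW]. *)
  have sub w : normc (w - s%:C * z) < (t1 - s) * normc z -> normc w < t1 * normc z.
    move=> ws; rewrite -[w](subrK (s%:C * z)).
    by apply: (le_lt_trans (normcD _ _)); rewrite sz //; lra.
  have L : t1 * normc z < 1 by nra.
  move=> /(_ ltac:(exact: mulr_gt0) (fun w ws => dh (lt_trans (sub w ws) L))
    (fun w ws => pos w (sub w ws)) (Hc _ (inball s st))).
  have := normc_Re (c (s%:C * z) * z); rewrite normcM ler_norml => /andP[+ _].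
  rewrite -/(v s); set N := normc (c _) => H1 H2.
  have -> : dW s = (2 * v s + (t1 - s) * cRe (c (s%:C * z) * z)) / (t1 - s) ^+ 3.
    by rewrite /dW; field; rewrite gt_eqF.
  rewrite divr_ge0 ?exprn_ge0 ?(ltW s1) //.
  have := ler_wpM2l (ltW s1) H1; nra.
have : 0 <= W t - W 0 by rewrite E mulr_ge0.
have -> : W 0 = cRe (h 0) / t1 ^+ 2 by rewrite /W /v mul0r subr0.
have t10 : 0 < t1 by lra.
have tt0 : 0 < t1 - t by lra.
rewrite subr_ge0 /W ler_pdivrMr ?exprn_gt0 // mulrAC ler_pdivlMr ?exprn_gt0 //.
by rewrite -/(v t) mulrC [v t * _]mulrC.
Qed.

(** The change of 1 / (1 + e^u) between level 1, reached just beyond the largest disk, and level 2,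
    still held inside it. *)
Let kappa : R := (1 + expR 1)^-1 - (1 + expR 2)^-1.

Let expR1_gt0 x : 0 < 1 + expR x :> R.
Proof. by rewrite ltr_wpDr ?expR_ge0. Qed.

Lemma kappa_gt0 : 0 < kappa.
Proof. by rewrite subr_gt0 ltf_pV2 ?posrE // ltrD2l ltr_expR ltr1n. Qed.

Lemma growth_bound_pos c : 0 <= cRe (h 0) -> cdiff h 0 c ->
  normc c <= (4 + K * (1 + expR 2 ^+ 2) + 2 * K ^+ 2 / kappa ^+ 2)
    * (1 + cRe (h 0)).
Proof.
move=> A0 hc; set A := cRe (h 0) in A0 *.
have K0 := growth_const_ge0; have k0 := kappa_gt0; have c0 := normc_ge0 c.
have D1 : 0 <= K * (1 + expR 2 ^+ 2) by rewrite mulr_ge0 // addr_ge0 // sqr_ge0.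
have D2 : 0 <= 2 * K ^+ 2 / kappa ^+ 2.
  by rewrite divr_ge0 ?sqr_ge0 // mulr_ge0 ?sqr_ge0.
set B1 := K * _ in D1 *; set B2 := 2 * K ^+ 2 / _ in D2 *.
(* For A <= 2 the hypothesis at 0 suffices and gives [B1]. Otherwise u(0) lies above both levels 1
   and 2. *)
have [A2|A2] := leP A 2.
  have := hK (w := 0) ltac:(by rewrite Normc.normc0 divr_gt0) hc; rewrite -/A.
  have E1 : 1 <= expR A by rewrite -expR0 ler_expR.
  have E2 : expR A <= expR 2 by rewrite ler_expR.
  move=> H; suff : normc c <= B1 by nra.
  apply: (le_trans _ (_ : normc c * expR A <= _)); first by rewrite ler_peMr.
  apply: (le_trans H); rewrite ler_wpM2l // lerD2l.
  by rewrite ler_pXn2r // nnegrE expR_ge0.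
suff [|] : normc c <= 4 * A \/ normc c <= B2 by nra.
(* Radii are capped at 1/2, beyond which [hK] says nothing. If u > 1 up to the cap,
   Borel-Caratheodory alone gives the bound 4 * A. *)
pose S := [set rho : R | 0 <= rho <= 1 / 2 /\ forall w, normc w < rho -> 1 < cRe (h w)].
have S0 : S 0 by split=> [|w]; [lra|rewrite ltNge normc_ge0].
have Sub : has_ubound S by exists (1 / 2) => x [/andP[]].
pose r := sup S.
have r0 : 0 <= r by apply: ub_le_sup.
have r2 : r <= 1 / 2 by apply: ge_sup => [|x [/andP[]]//]; exists 0.
have Hr w : normc w < r -> 1 < cRe (h w).
  by move=> /(sup_gt (ex_intro _ 0 S0))[rho [_ H]] /H.
have [all|] := pselect (forall w, normc w < 1 / 2 -> 1 < cRe (h w)).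
  left; have : 1 / 2 * normc c <= 2 * A; last by lra.
  apply: positive_re_deriv hc => // w; rewrite subr0 => w2.
    by apply: dh; lra.
  by rewrite ltW // (lt_trans _ (all w w2)).
move=> /existsNP[w0 /not_implyP[w02 /negP]]; rewrite -leNgt => hw0.
have rlt : r < 1 / 2.
  by rewrite (le_lt_trans _ w02) // leNgt; apply/negP => /Hr; rewrite ltNge hw0.
(* At t = t1 * (1 - sg), [ray_decay] leaves at least the fraction sg^2 of A, and sg is chosen to
   make this the level 2. *)
pose sg := Num.sqrt (2 / A).
have A20 : 0 < 2 / A by rewrite divr_gt0 //; lra.
have sgA : sg ^+ 2 * A = 2 by rewrite sqr_sqrtr ?ltW // divfK // gt_eqF //; lra.
have sg0 : 0 < sg by rewrite sqrtr_gt0.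
have sg1 : sg < 1.
  rewrite ltNge; apply/negP => sg1.
  have : 1 <= sg ^+ 2 by rewrite exprn_ege1.
  by nra.
(* Maximality of r gives a point z with u(z) <= 1 and r <= |z| < r + d. Keeping d > 0 avoids a
   compactness argument for such a point on the circle itself. *)
have main d : 0 < d -> kappa <= K * (d + r * sg).
  move=> d0; have rr : r < Num.min (r + d) (1 / 2) by rewrite lt_min rlt; lra.
  have : ~ S (Num.min (r + d) (1 / 2)).
    by move=> /(ub_le_sup Sub); rewrite -/r; lra.
  move=> /not_andP[|/existsNP[z /not_implyP[+ /negP]]].
    by rewrite ge_min lexx orbT => /negP; rewrite andbT; lra.
  rewrite lt_min -leNgt => /andP[zd z2] hz.
  have rz : r <= normc z.
    by rewrite leNgt; apply/negP => /Hr; rewrite ltNge hz.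
  have z0 : 0 < normc z.
    rewrite normc_gt0; apply/eqP => z0; move: hz; rewrite z0 -/A; lra.
  pose t1 := r / normc z.
  have t1z : t1 * normc z = r by rewrite divfK // gt_eqF.
  have t10 : 0 <= t1 by rewrite divr_ge0 // ltW.
  have t11 : t1 <= 1 by rewrite ler_pdivrMr // mul1r.
  pose t := t1 * (1 - sg).
  have t0 : 0 <= t by rewrite mulr_ge0 //; lra.
  have tt1 : t <= t1 by rewrite /t; nra.
  have vt : 2 <= cRe (h (t%:C * z)).
    have [t1E|t1N] := eqVneq t1 0.
      by rewrite /t t1E mul0r mul0r -/A ltW.
    have t1P : 0 < t1 by rewrite lt_neqAle eq_sym t1N.
    have tlt : t < t1 by rewrite /t; nra.
    have z1 : normc z < 1 by lra.
    have pos w : normc w < t1 * normc z -> 0 <= cRe (h w).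
      by rewrite t1z => /Hr; lra.
    have := ray_decay t0 tlt t11 z1 z0 pos.
    have -> : t1 - t = t1 * sg by rewrite /t; ring.
    by rewrite exprMn -mulrA ler_pM2l ?exprn_gt0 // -/A sgA.
  have := ray_lipschitz z2 (t := t) ltac:(apply/andP; split; lra).
  have -> : K * normc z * (1 - t) = K * (normc z - r * (1 - sg)).
    by rewrite /t -t1z; ring.
  have G1 : (1 + expR 1)^-1 <= (1 + expR (cRe (h z)))^-1.
    by rewrite lef_pV2 ?posrE // lerD2l ler_expR.
  have G2 : (1 + expR (cRe (h (t%:C * z))))^-1 <= (1 + expR 2)^-1.
    by rewrite lef_pV2 ?posrE // lerD2l ler_expR.
  have G3 : K * (normc z - r * (1 - sg)) <= K * (d + r * sg).
    by rewrite ler_wpM2l //; lra.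
  by rewrite /kappa; lra.
(* The limit d -> 0 of [main]: were this false, the d chosen below would use up less than half of
   the gap. *)
have krs : kappa <= K * (r * sg).
  rewrite leNgt; apply/negP => lt.
  have K1 : 0 < K + 1 by lra.
  have d0 : 0 < (kappa - K * (r * sg)) / (2 * (K + 1)).
    by rewrite divr_gt0 ?subr_gt0 // mulr_gt0.
  have := main _ d0; set d := _ / _ in d0 *.
  have dE : d * (2 * (K + 1)) = kappa - K * (r * sg).
    by rewrite divfK // gt_eqF // mulr_gt0.
  by nra.
have rP : 0 < r.
  by rewrite lt_neqAle r0 andbT; apply/eqP => rE; move: krs; rewrite -rE mul0r mulr0; lra.
have kA : kappa ^+ 2 * A <= 2 * K ^+ 2 * r ^+ 2.
  have -> : 2 * K ^+ 2 * r ^+ 2 = (K * (r * sg)) ^+ 2 * A.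
    by rewrite -sgA; ring.
  have kr0 : 0 <= K * (r * sg) by rewrite (le_trans (ltW k0)).
  by rewrite ler_wpM2r // ler_pXn2r // nnegrE ltW.
right; have rc : r * normc c <= 2 * A.
  apply: positive_re_deriv hc => // w; rewrite subr0 => wr.
    by apply: dh; lra.
  by rewrite ltW // (lt_trans _ (Hr w wr)).
(* Multiplying [rc] by kappa^2 and inserting [kA] gives kappa^2 |c| <= 4 K^2 r, and r < 1/2. *)
rewrite ler_pdivlMr ?exprn_gt0 //.
have : r * (normc c * kappa ^+ 2) <= r * (4 * K ^+ 2 * r).
  have := ler_wpM2l (sqr_ge0 kappa) rc; nra.
rewrite ler_pM2l // => /le_trans; apply.
have : 0 <= K ^+ 2 by rewrite sqr_ge0.
by nra.
Qed.

End LandauGrowth.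

Section GrowthBound.
Context {R : realType}.

(** The hypothesis is invariant under h -> -h, which settles a negative real part at 0. C depends on
    K only, so one constant serves all analytic disks; [|K|] appears in it because K >= 0 is known
    only once some h is given. *)
Lemma growth_bound (K : R) : exists2 C : R, 0 <= C &
  forall (h : R[i] -> R[i]) c,
  (forall w, normc w < 1 -> exists c, cdiff h w c) ->
  (forall w c, normc w < 1 / 2 -> cdiff h w c ->
    normc c * expR (cRe (h w)) <= K * (1 + expR (cRe (h w)) ^+ 2)) ->
  cdiff h 0 c -> normc c <= C * (1 + `|cRe (h 0)|).
Proof.
pose kappa : R := (1 + expR 1)^-1 - (1 + expR 2)^-1.
exists (4 + `|K| * (1 + expR 2 ^+ 2) + 2 * K ^+ 2 / kappa ^+ 2).
  apply: addr_ge0; first apply: addr_ge0 => //.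
  by rewrite mulr_ge0 ?invr_ge0 ?sqr_ge0 // mulr_ge0 // sqr_ge0.
move=> h c dh hK hc; have K0 := growth_const_ge0 dh hK.
rewrite (ger0_norm K0); have [h0|h0] := leP 0 (cRe (h 0)).
  by rewrite ger0_norm //; exact: growth_bound_pos dh hK c h0 hc.
rewrite ltr0_norm //; have := @growth_bound_pos R (fun w => - h w) K _ _ (- c).
rewrite normcN cReN oppr_ge0; apply; last exact: cdiffN.
- by move=> w /dh[d /cdiffN Hd]; exists (- d).
- move=> w d w2 hd.
  have Hd : cdiff h w (- d).
    by have := cdiffN hd; under [X in cdiff X]funext => v do rewrite opprK.
  have := hK w (- d) w2 Hd; rewrite normcN cReN expRN.
  have := expR_gt0 (cRe (h w)); set E := expR _ => E0 H.
  have -> : normc d * E^-1 = (normc d * E) / E ^+ 2 by field; rewrite gt_eqF.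
  have -> : K * (1 + E^-1 ^+ 2) = K * (1 + E ^+ 2) / E ^+ 2.
    by field; rewrite gt_eqF.
  by rewrite ler_wpM2r // invr_ge0 sqr_ge0.
- by rewrite ltW.
Qed.

End GrowthBound.

(** * Differentials between normed spaces *)

Section VectorDiff.
Context {R : realType}.
Implicit Types (V W : normedModType R[i]).

Lemma diff1Z V (f : R[i] -> V) z w : differentiable f z ->
  'd f z w = w *: 'd f z 1.
Proof.
by move=> df; rewrite -linearZ; congr ('d f z _); rewrite -[RHS]/(w * 1) mulr1.
Qed.

Lemma near_eq_diff V W (f g : V -> W) (z : V) :
  {near z, f =1 g} -> differentiable f z ->
  differentiable g z /\ 'd g z = 'd f z :> (V -> W).
Proof.
move=> fg df.
have cf : continuous ('d f z) := diff_continuous df.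
have E : g \o shift z = cst (g z) + ('d f z : V -> W) +o_ 0 id.
  have /eqaddoP H := diff_locally df.
  apply/eqaddoP => e e0; have := H e e0; apply: filter_app.
  have : \forall x \near (0 : V), f (x + z) = g (x + z).
    by have := fg; rewrite (near_shift 0 z); apply: filterS => x /=; rewrite subr0.
  apply: filterS => x fgx.
  rewrite !fctE /= fgx; have -> := nbhs_singleton fg; exact.
have dE := diff_unique cf E.
split; last exact: dE.
by apply/diff_locallyP; rewrite dE; split.
Qed.

Lemma diff_comp1 V W (f : R[i] -> V) (g : V -> W) z :
  differentiable f z -> differentiable g (f z) ->
  'd (g \o f) z 1 = 'd g (f z) ('d f z 1).
Proof.
move=> df dg.
exact: (congr1 (fun h : R[i] -> W => h 1) (diff_comp df dg)).
Qed.

Lemma diff_comp_cplx V (f : V -> R[i]) (g : R[i] -> R[i]) (z : V) c (v : V) :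
  differentiable f z -> cdiff g (f z) c ->
  differentiable (g \o f) z /\ 'd (g \o f) z v = c * 'd f z v.
Proof.
move=> df gc; have [dg dgE] := cdiff_is_diff gc; split.
  exact: differentiable_comp.
have E1 : 'd (g \o f) z v = 'd g (f z) ('d f z v).
  exact: (congr1 (fun h : V -> R[i] => h v) (diff_comp df dg)).
apply: (etrans E1); apply: (etrans (diffC1 _ dg)).
exact: (congr1 (fun x => x * _) dgE).
Qed.

Lemma differentiable_affine V (a : V) (b : V) (z : R[i]) :
  differentiable (fun w : R[i] => a + w *: b) z /\
  'd (fun w : R[i] => a + w *: b) z 1 = b.
Proof.
have d1 : is_diff z (fun w : R[i] => w *: b) (fun w => w *: b).
  exact: is_diff_scalel.
have d2 : is_diff z (cst a + (fun w : R[i] => w *: b)) (0 + (fun w => w *: b)).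
  exact: is_diffD.
split; first exact: (@ex_diff _ _ _ _ _ _ _ d2).
have := @diff_val _ _ _ _ _ _ _ d2 => /(congr1 (fun h : R[i] -> V => h 1)) H.
by apply: (etrans H); rewrite fctE /= add0r scale1r.
Qed.

End VectorDiff.

(** * Analytic disks and the Kobayashi-Royden pseudometric *)

Section Disks.
Context {R : realType} (M : complexManifold R).
Let ax := cm_axioms M.

Lemma analytic_diskP (phi : complex_plane R -> M) (z : R[i]) :
  analytic_disk phi -> normc z < 1 ->
  {for z, continuous phi} /\
  differentiable (chart (phi z) \o phi : R[i] -> 'rV[R[i]]_(cm_dim M)) z.
Proof. by move=> Hphi z1; exact: Hphi. Qed.

Lemma near_chart_dom (phi : complex_plane R -> M) (z : R[i]) :
  {for z, continuous phi} -> exists2 r : R, 0 < r &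
    forall w, normc (w - z) < r -> chart_dom (phi z) (phi w).
Proof.
move=> cphi; have /cphi/nbhsCP[r r0 Hr] : nbhs (phi z) (chart_dom (phi z)).
  apply: open_nbhs_nbhs; split; first exact: open_chart_dom.
  exact: chart_dom_center.
by exists r.
Qed.

Lemma cdiff_disk (f : M -> complex_plane R) (phi : complex_plane R -> M) (z : R[i]) :
  holomorphic f -> analytic_disk phi -> normc z < 1 ->
  cdiff (f \o phi) z
    (differential f (@differential _ _ _ _ _ phi z 1)).
Proof.
move=> hf hphi z1; have [cphi dphi] := analytic_diskP hphi z1.
have [r r0 Hr] := near_chart_dom cphi.
have [_ df] := hf (phi z) I.
pose F : 'rV[R[i]]_(cm_dim M) -> R[i] := local_rep f (phi z).
pose Phi : R[i] -> 'rV[R[i]]_(cm_dim M) := chart (phi z) \o phi.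
have dF : differentiable F (Phi z) by exact: df.
have dPhi : differentiable Phi z by exact: dphi.
have dFP := differentiable_comp dPhi dF.
have := differentiable_cdiff dFP; rewrite (diff_comp1 dPhi dF).
apply: (cdiff_near r0) => w wz.
rewrite /= /F /local_rep /= /Phi /= (chartK ax) //.
exact: Hr.
Qed.

Lemma kobayashi_ge0 (z : M) (xi : tangent z) : 0 <= kobayashi xi.
Proof.
rewrite /kobayashi; set S := [set _ | _].
have [->|/set0P S0] := eqVneq S set0; first by rewrite inf0.
by apply: lb_le_inf => // _ [phi [a [_ _ _ _ ->]]]; rewrite invr_ge0 normc_ge0.
Qed.

Lemma kobayashi_le (z : M) (xi : tangent z) (phi : complex_plane R -> M) (a : R[i]) :
  analytic_disk phi -> phi 0 = z -> a != 0 ->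
  @differential _ _ _ _ _ phi 0 1 = a *: xi -> kobayashi xi <= (normc a)^-1.
Proof.
move=> h1 h2 h3 h4; apply: ge_inf; last by exists phi, a; split.
by exists 0 => _ [? [? [_ _ _ _ ->]]]; rewrite invr_ge0 normc_ge0.
Qed.

(** The disk of radius 1 - |z| about z is reparametrized affinely. A Moebius map would give a
    sharper bound, but a bound on |z| < 1/2 is all that the growth estimate requires. *)
Lemma kobayashi_disk (phi : complex_plane R -> M) (z : R[i]) :
  analytic_disk phi -> normc z < 1 ->
  kobayashi (@differential _ _ _ _ _ phi z 1)
    <= (1 - normc z)^-1.
Proof.
move=> hphi z1; pose s : R := 1 - normc z.
have s0 : 0 < s by rewrite subr_gt0.
pose L (w : R[i]) : R[i] := z + w *: s%:C.
have L0 : L 0 = z by rewrite /L scale0r addr0.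
have Lin w : normc w < 1 -> normc (L w) < 1.
  move=> w1; apply: (le_lt_trans (normcD _ _)).
  rewrite -[w *: _]/(w * s%:C) normcM normcR gtr0_norm // /s.
  by have := normc_ge0 w; rewrite /s in s0; nra.
have dL w : differentiable L w /\ 'd L w 1 = s%:C.
  exact: differentiable_affine.
have cL w : {for w, continuous L} by apply: differentiable_continuous; case: (dL w).
have hpsi : analytic_disk (phi \o L : complex_plane R -> M).
  move=> w w1; have [cphi dphi] := analytic_diskP hphi (Lin w w1).
  split; first exact: (continuous_comp (cL w) cphi).
  exact: (differentiable_comp (proj1 (dL w)) dphi).
have sN : normc s%:C = s by rewrite normcR gtr0_norm.
have s0C : s%:C != 0 by rewrite -normc_gt0 sN.
rewrite -[leRHS]/(s^-1) -sN.
apply: (kobayashi_le hpsi) => //=; first by rewrite L0.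
have [_ d0] := analytic_diskP hphi (Lin 0 ltac:(by rewrite Normc.normc0)).
(* [L 0] equals z only propositionally and the selected chart depends on the point, so this
   dependence is isolated in a function that can be rewritten. *)
pose D w : 'rV[R[i]]_(cm_dim M) := 'd (chart (phi w) \o phi : R[i] -> _) w 1.
have E1 := diff_comp1 (proj1 (dL 0)) d0.
have E2 := congr1 _ (proj2 (dL 0)) : 'd (chart (phi (L 0)) \o phi : R[i] -> _) (L 0) ('d L 0 1) = _ .
apply: (etrans E1); apply: (etrans E2); apply: (etrans (diff1Z _ d0)).
exact: (congr1 (fun w => s%:C *: D w) L0).
Qed.

(** The disk is a straight line in the chart at z. Holomorphy is tested in the chart selected at
    each point of its image, where it follows from the transition maps. *)
Lemma affine_disk (z : M) (xi : tangent z) (a : R[i]) :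
  (forall w, normc w < 1 ->
    (chart z @` chart_dom z) (chart z z + w *: (a *: xi))) ->
  exists phi : complex_plane R -> M,
    [/\ analytic_disk phi, phi 0 = z &
      @differential _ _ _ _ _ phi 0 1 = a *: xi].
Proof.
pose V := 'rV[R[i]]_(cm_dim M) => Lin.
pose x : V := xi.
pose L (w : R[i]) : V := chart z z + w *: (a *: x).
have L0 : L 0 = chart z z by rewrite /L scale0r addr0.
have dL w : differentiable L w /\ 'd L w 1 = a *: x.
  exact: differentiable_affine.
have cL w : {for w, continuous L} by apply: differentiable_continuous; case: (dL w).
pose phi (w : complex_plane R) : M := chart_inv z (L w).
have phi_dom w : normc w < 1 -> chart_dom z (phi w) /\ chart z (phi w) = L w.
  by move=> /Lin[q zq qL]; rewrite /phi /L -qL (chartK ax).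
have phi0 : phi 0 = z by rewrite /phi L0 (chartK ax) //; exact: chart_dom_center.
have hphi : analytic_disk phi.
  move=> w w1; have [dw cw] := phi_dom w w1; split.
    apply: (continuous_comp (cL w)); rewrite -cw.
    exact: continuous_chart_inv.
  have dT := holomorphic_transition ax dw (chart_dom_center ax (phi w)).
  rewrite cw in dT.
  exact: (differentiable_comp (proj1 (dL w)) dT).
exists phi; split => //.
have E : {near (0 : R[i]), L =1 chart z \o phi}.
  apply/nbhsCP; exists 1; first exact: ltr01.
  by move=> w; rewrite subr0 => /phi_dom[_ <-].
have [_ d1] := near_eq_diff E (proj1 (dL 0)).
pose D p : V := 'd (chart p \o phi : R[i] -> V) 0 1.
apply: (etrans (congr1 D phi0)).
exact: (etrans (congr1 (fun h : R[i] -> V => h 1) d1) (proj2 (dL 0))).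
Qed.

Lemma exists_affine_disk (z : M) (xi : tangent z) :
  exists (phi : complex_plane R -> M) (a : R[i]),
    [/\ analytic_disk phi, phi 0 = z, a != 0 &
      @differential _ _ _ _ _ phi 0 1 = a *: xi].
Proof.
pose V := 'rV[R[i]]_(cm_dim M).
pose c : V := chart z z.
have : nbhs c (chart z @` chart_dom z).
  apply: open_nbhs_nbhs; split; first exact: open_chart_img.
  by exists z => //; exact: chart_dom_center.
move=> /nbhs_normP[e /= e0 He].
pose x : V := xi.
have x1 : 0 < 1 + `|x| by rewrite ltr_pwDl.
(* Norms take values in [R[i]], so [e] and [a] are positive complex numbers, hence real. The summand
   1 covers xi = 0. *)
pose a : R[i] := e / (1 + `|x|).
have a0 : 0 < a by rewrite divr_gt0.
have [w w1|phi [h1 h2 h3]] := @affine_disk z xi a; last first.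
  by exists phi, a; split => //; rewrite gt_eqF.
apply: He => /=; rewrite opprD addNKr normrN.
have -> : `|w *: (a *: x)| = (normc w)%:C * ((normc a)%:C * `|x|).
  exact: etrans (normrZ _ _) (congr1 (fun y => (normc w)%:C * y) (normrZ _ _)).
have [ra aE] := posC_real a0.
have -> : (normc a)%:C = a by rewrite aE normcR gtr0_norm.
have w1C : (normc w)%:C <= 1 by rewrite lecR ltW.
apply: (le_lt_trans (_ : _ <= a * `|x|)).
  by rewrite -[leRHS]mul1r ler_wpM2r // mulr_ge0 // ltW.
by rewrite mulrAC ltr_pdivrMr // ltr_pM2l // ltrDr.
Qed.

(** The infimum of the empty set is 0 by convention, so a positive lower bound needs the affine disk
    as a witness of nonemptiness. *)
Lemma kobayashi_ge (z : M) (xi : tangent z) (B : R) :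
  (forall (phi : complex_plane R -> M) a, analytic_disk phi -> phi 0 = z ->
    a != 0 -> @differential _ _ _ _ _ phi 0 1 = a *: xi -> B <= (normc a)^-1) ->
  B <= kobayashi xi.
Proof.
move=> H; apply: lb_le_inf.
  have [phi [a [h1 h2 h3 h4]]] := exists_affine_disk xi.
  by exists (normc a)^-1, phi, a; split.
by move=> _ [phi [a [h1 h2 h3 h4 ->]]]; exact: H h1 h2 h3 h4.
Qed.

End Disks.

(** * The two inclusions *)

Section Inclusions.
Context {R : realType} (M : complexManifold R).

Lemma holomorphic_exp (f : M -> complex_plane R) (lambda : R[i]) :
  holomorphic f ->
  let g z := to_sphere (cexp (lambda * (f z : R[i]))) in
  holomorphic g /\ forall (z : M) (xi : tangent z),
    (differential g xi : R[i]) =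
      cexp (lambda * (f z : R[i])) * lambda * (differential f xi : R[i]).
Proof.
move=> hf g.
pose e (w : R[i]) := cexp (lambda * w).
have de w : cdiff e w (cexp (lambda * w) * lambda).
  apply: (@cdiff_comp _ ( *%R lambda) (@cexp R)); last exact: cdiff_cexp.
  by have := cdiffMl lambda (cdiff_id w); rewrite mulr1.
pose F z : 'rV[R[i]]_(cm_dim M) -> R[i] := local_rep f z.
have main z (xi : tangent z) : differentiable (e \o F z) (chart z z) /\
    'd (e \o F z) (chart z z) xi = cexp (lambda * F z (chart z z)) * lambda *
      'd (F z) (chart z z) xi.
  by apply: diff_comp_cplx; [have [] := hf z I|exact: de].
have FE z : F z (chart z z) = f z.
  by rewrite /F /local_rep /= (chartK (cm_axioms M)) //; exact: chart_dom_center (cm_axioms M) _.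
split; last first.
  move=> z xi; apply: (etrans (proj2 (main z xi))).
  exact: (congr1 (fun y => cexp (lambda * y) * lambda * _) (FE z)).
move=> z _; split; last exact: (proj1 (main z 0)).
have cf : {for z, continuous f} by have [] := hf z I.
have ce : {for f z, continuous e} :=
  (continuousCP _ _).2 (cdiff_cont (de (f z))).
have c1 : {for z, continuous (e \o f)} := continuous_comp cf ce.
exact: (continuous_comp c1 (@one_point_compactification_some_continuous _ _)).
Qed.

Lemma spherical_exp (f : M -> complex_plane R) (lambda : R[i]) (z : M) (xi : tangent z) :
  holomorphic f ->
  spherical_metric (differential (fun z => to_sphere (cexp (lambda * (f z : R[i])))) xi) =
  2 * (expR (cRe (lambda * (f z : R[i]))) * normc lambda * normc (differential f xi)) /
  (1 + expR (cRe (lambda * (f z : R[i]))) ^+ 2).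
Proof.
move=> hf; have [_ dE] := holomorphic_exp lambda hf.
by rewrite /spherical_metric dE !normcM !normc_cexp.
Qed.

Lemma spherical_bound (x : R) : 0 < x -> 2 * x / (1 + x ^+ 2) <= 1.
Proof.
move=> x0; rewrite ler_pdivrMr ?ltr_pwDl ?sqr_ge0 // mul1r.
by rewrite -subr_ge0 (_ : _ - _ = (1 - x) ^+ 2) ?sqr_ge0 //; ring.
Qed.

Lemma bloch_semi_bloch : bloch_functions M `<=` semi_bloch_functions M.
Proof.
move=> f [hf [C HC]]; split=> // lambda.
split; first by have [] := holomorphic_exp lambda hf.
exists (normc lambda * C) => z xi; rewrite spherical_exp //.
have E0 := expR_gt0 (cRe (lambda * (f z : R[i]))); set E := expR _ in E0 *.
have L0 := normc_ge0 lambda; have D0 := normc_ge0 (differential f xi).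
apply: (le_trans (_ : _ <= normc lambda * normc (differential f xi))).
  rewrite (_ : _ / _ = 2 * E / (1 + E ^+ 2) * (normc lambda * normc (differential f xi))).
    by rewrite ler_piMl ?mulr_ge0 // spherical_bound.
  ring.
by rewrite -mulrA ler_wpM2l.
Qed.

Lemma holomorphic_to_sphere (f : M -> complex_plane R) :
  holomorphic f -> holomorphic (@to_sphere R \o f).
Proof.
move=> hf z _; have [cf df] := hf z I; split; last exact: df.
exact: (continuous_comp cf (@one_point_compactification_some_continuous _ _)).
Qed.

Lemma semi_bloch_normal : semi_bloch_functions M `<=` normal_functions M.
Proof.
move=> f [hf Hf]; split=> //.
have [_ [C1 HC1]] := Hf 1.
(* On |w| < 1/2 the Kobayashi length of phi' is at most 2; this cancels the 2 of the spherical
   metric, so K = |C1| serves for every disk. *)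
have [C C0 HC] := growth_bound `|C1|.
split; first exact: holomorphic_to_sphere.
have key (z : M) (xi : tangent z) :
    normc (differential f xi) / ((C + 1) * (1 + normc (f z : R[i]))) <= kobayashi xi.
  apply: kobayashi_ge => phi a hphi phi0 a0; subst z => dphi.
  have N0 : normc (0 : R[i]) < 1 by rewrite Normc.normc0.
  have dh w : normc w < 1 -> exists c, cdiff (f \o phi) w c.
    by move=> w1; eexists; exact: (cdiff_disk hf hphi w1).
  have cE w c : normc w < 1 -> cdiff (f \o phi) w c ->
      c = differential f (@differential _ _ _ _ _ phi w 1).
    move=> w1 /cdiff_is_diff[_ <-].
    by have [_ <-] := cdiff_is_diff (cdiff_disk hf hphi w1).
  have hK w c : normc w < 1 / 2 -> cdiff (f \o phi) w c ->
      normc c * expR (cRe ((f \o phi) w)) <= `|C1| * (1 + expR (cRe ((f \o phi) w)) ^+ 2).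
    move=> w2 hc; have w1 : normc w < 1 by lra.
    have := HC1 (phi w) (@differential _ _ _ _ _ phi w 1).
    rewrite (spherical_exp _ _ hf) mul1r Normc.normc1 mulr1 -(cE w c w1 hc).
    have k1 := kobayashi_disk hphi w1.
    have k0 := kobayashi_ge0 (@differential _ _ _ _ _ phi w 1).
    have k2 : kobayashi (@differential _ _ _ _ _ phi w 1) <= 2.
      by apply: (le_trans k1); rewrite -[leRHS]invrK lef_pV2 ?posrE; lra.
    set E := expR _; have E2 : 0 < 1 + E ^+ 2 by rewrite ltr_pwDl ?sqr_ge0.
    rewrite ler_pdivrMr // => H.
    have L : C1 * kobayashi (@differential _ _ _ _ _ phi w 1) <= `|C1| * 2.
      by apply: (le_trans (ler_norm _)); rewrite normrM (ger0_norm k0) ler_wpM2l.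
    have := ler_wpM2r (ltW E2) L.
    by move=> ?; nra.
  have := HC _ _ dh hK (cdiff_disk hf hphi N0); rewrite dphi.
  have -> : (differential f (a *: xi) : R[i]) = a * (differential f xi : R[i]).
    exact: linearZ.
  have -> : (f \o phi) 0 = f (phi 0) by [].
  have := normc_Re (f (phi 0) : R[i]); have := normc_ge0 (f (phi 0) : R[i]).
  set W := normc (f (phi 0)); set D := normc (differential f xi).
  rewrite normcM -/D => W0 RW H.
  have D0 : 0 < (C + 1) * (1 + W) by rewrite mulr_gt0 //; lra.
  have n0 : 0 < normc a by rewrite normc_gt0.
  rewrite ler_pdivrMr // mulrC ler_pdivlMr // mulrC.
  apply: (le_trans H).
  by rewrite ler_pM //; lra.
(* One factor 2 comes from the spherical metric, the other from 1 + W <= 2 (1 + W^2). *)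
exists (4 * (C + 1)) => z xi; have := key z xi.
have W0 := normc_ge0 (f z : R[i]); have D0 := normc_ge0 (differential f xi).
have K0 := kobayashi_ge0 xi.
rewrite /spherical_metric.
have -> : chart (to_sphere (f z)) (to_sphere (f z)) = (f z : R[i]) by [].
rewrite ler_pdivrMr; last by rewrite mulr_gt0 //; lra.
rewrite ler_pdivrMr ?ltr_pwDl ?sqr_ge0 //.
set W := normc (f z) in W0 *; set D := normc (differential f xi) in D0 * => H.
apply: (le_trans (_ : _ <= 2 * (kobayashi xi * ((C + 1) * (1 + W))))); first by lra.
have -> : 4 * (C + 1) * kobayashi xi * (1 + W ^+ 2) =
  2 * (kobayashi xi * ((C + 1) * (2 * (1 + W ^+ 2)))) by ring.
rewrite ler_pM2l // ler_wpM2l // ler_wpM2l //; first by lra.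
by nra.
Qed.

End Inclusions.

(** * The strip *)

Section StripSpace.
Variable R : realType.

Definition strip := {w : R[i] | `|cIm w| < 1}.
HB.instance Definition _ := Choice.on strip.
Definition strip_top := initial_topology (val : strip -> R[i]).
HB.instance Definition _ := Topological.on strip_top.

Implicit Types p q : strip_top.

Lemma nbhs_stripP p (U : set strip_top) :
  nbhs p U <-> exists2 e : R, 0 < e &
    forall q, normc (val q - val p) < e -> U q.
Proof.
split=> [[_ [[V oV <-] Vp VU]]|[e e0 H]].
  have /nbhsCP[e e0 He] : nbhs (val p) V by apply: open_nbhs_nbhs.
  by exists e => // q /He; exact: VU.
have : nbhs (val p) [set w | normc (w - val p) < e] by apply/nbhsCP; exists e.
move=> /(@initial_continuous _ _ (val : strip -> R[i]) p) N.
by apply: (filterS _ (N : nbhs p _)) => q; exact: H.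
Qed.

Lemma strip_hausdorff : hausdorff_space strip_top.
Proof.
move=> p q /= pq; apply/val_inj/eqP; rewrite -subr_eq0 -normc_eq0.
apply/negPn/negP => d0; have {}d0 : 0 < normc (val p - val q).
  by rewrite lt_neqAle eq_sym d0 normc_ge0.
set d := normc _ in d0; have d2 : 0 < d / 2 by rewrite divr_gt0.
have [x [/= px qx]] : [set x : strip_top | normc (val x - val p) < d / 2] `&`
    [set x : strip_top | normc (val x - val q) < d / 2] !=set0.
  by apply: pq; apply/nbhs_stripP; exists (d / 2).
have := normcD (val p - val x) (val x - val q); rewrite subrKA normcB_sym -/d.
by move: px qx; set n1 := normc _; set n2 := normc _; lra.
Qed.

Lemma ratr_approx (x r : R) : 0 < r -> exists a : rat, `|x - ratr a| < r.
Proof.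
move=> r0; have xr : x - r < x + r by lra.
have [a] := rat_in_itvoo xr; rewrite in_itv /= => /andP[a1 a2].
by exists a; rewrite ltr_norml; apply/andP; split; lra.
Qed.

Lemma strip_second_countable : @second_countable strip_top.
Proof.
pose B (t : rat * rat * nat) : set strip_top :=
  [set q | normc (val q - Complex (ratr t.1.1) (ratr t.1.2)) < t.2.+1%:R^-1].
exists (range B); first exact: sub_countable (card_image_le _ _) (countableP _).
split=> [_ [t _ <-]|p U /nbhs_stripP[e e0 He]].
  rewrite openE => q /= qt; apply/nbhs_stripP.
  exists (t.2.+1%:R^-1 - normc (val q - Complex (ratr t.1.1) (ratr t.1.2))).
    by rewrite subr_gt0.
  move=> q' qq'; rewrite /B /=.
  have := normcD (val q' - val q) (val q - Complex (ratr t.1.1) (ratr t.1.2)).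
  by rewrite subrKA; move=> /le_lt_trans; apply; rewrite -ltrBrDr.
(* A ball of radius 1/(n+1) that contains p has diameter at most 2/(n+1), hence lies in the e-ball
   about p. *)
pose n := Num.truncn (2 / e).
have ne : 2 * n.+1%:R^-1 < e.
  have n0 : 0 < n.+1%:R :> R by [].
  rewrite ltr_pdivrMr // mulrC -ltr_pdivrMr //.
  exact: truncnS_gt.
have n0 : 0 < n.+1%:R^-1 :> R by rewrite invr_gt0.
have n20 : 0 < n.+1%:R^-1 / 2 :> R by rewrite divr_gt0.
have [a A1] := ratr_approx (cRe (val p)) n20.
have [b A2] := ratr_approx (cIm (val p)) n20.
have pB : B (a, b, n) p.
  apply: (le_lt_trans (normc_le_ReIm _)); rewrite !cReD !cImD !cReN !cImN /=.
  by rewrite [ltRHS]splitr ltrD.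
exists (B (a, b, n)); first by split => //; exists (a, b, n).
move=> q Bq; apply: He; rewrite /B /= in Bq pB.
have := normcD (val q - Complex (ratr a) (ratr b)) (Complex (ratr a) (ratr b) - val p).
rewrite subrKA [X in _ <= _ + X]normcB_sym => /le_lt_trans; apply.
by apply: lt_trans ne; rewrite mulrDl !mul1r ltrD.
Qed.

(** The inclusion serves as a global chart, with values in the row vectors that [complexManifold]
    prescribes as model. Off the strip [insubd] returns the junk value p. *)
Definition strip_space : chartedSpace 'rV[R[i]]_1 :=
  @ChartedSpace R 'rV[R[i]]_1 strip_top (fun=> setT)
    (fun _ q => const_mx (val q)) (fun p v => insubd p (v 0 0)).

Lemma nbhs_row1P (v : 'rV[R[i]]_1) (U : set 'rV[R[i]]_1) :
  nbhs v U <-> exists2 e : R, 0 < e &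
    forall u : 'rV[R[i]]_1, normc (u 0 0 - v 0 0) < e -> U u.
Proof.
split=> [[P vP PU]|[e e0 H]].
  have /nbhsCP[e e0 He] := vP 0 0; exists e => // u ue; apply: PU => i j.
  by rewrite !ord1; exact: He.
exists (fun _ _ => [set w | normc (w - v 0 0) < e]) => [i j|u ue].
  by rewrite !ord1; apply/nbhsCP; exists e.
by apply: H; exact: ue.
Qed.

Lemma strip_insubd p (w : R[i]) : `|cIm w| < 1 -> val (insubd p w : strip_top) = w.
Proof. by move=> w1; rewrite insubdK. Qed.

Lemma near_strip q : exists2 e : R, 0 < e &
  forall w, normc (w - val q) < e -> `|cIm w| < 1.
Proof.
exists (1 - `|cIm (val q)|) => [|w wq]; first by rewrite subr_gt0 (valP q).
rewrite -[w](subrK (val q)) cImD; apply: (le_lt_trans (ler_normD _ _)).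
by have := normc_Im (w - val q); lra.
Qed.

Lemma strip_axioms : complex_manifold_axioms strip_space.
Proof.
split.
- exact: strip_hausdorff.
- exact: strip_second_countable.
- by [].
- by move=> p; exact: openT.
- move=> p; rewrite openE => _ [q _ <-]; apply/nbhs_row1P.
  have [e e0 He] := near_strip q; exists e => // u; rewrite mxE => /He u1.
  exists (insubd q (u 0 0)) => //=.
  by apply/rowP => i; rewrite mxE strip_insubd // ord1.
- by move=> p q _; apply: val_inj; rewrite /= mxE strip_insubd // (valP q).
- move=> p q _ U /nbhs_row1P[e e0 He]; apply/nbhs_stripP; exists e => // q' qq'.
  by apply: He; rewrite !mxE.
- move=> p q _ U /nbhs_stripP[e e0 He]; apply/nbhs_row1P.
  have [e1 e10 He1] := near_strip q.
  exists (Num.min e e1) => [|u]; first by rewrite lt_min e0.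
  rewrite /= mxE lt_min => /andP[ue /He1 u1]; apply: He.
  by rewrite /= mxE !strip_insubd // (valP q).
- move=> p q x _ _.
  suff E : {near (const_mx (val x) : 'rV[R[i]]_1), id =1
      (@chart _ _ strip_space q \o @chart_inv _ _ strip_space p)}.
    have did : differentiable (id : 'rV[R[i]]_1 -> 'rV[R[i]]_1) (const_mx (val x)).
      exact: ex_diff.
    by have [H _] := near_eq_diff E did; exact: H.
  apply/nbhs_row1P; have [e e0 He] := near_strip x; exists e => // u.
  rewrite mxE => /He u1; apply/rowP => i.
  by rewrite /= mxE strip_insubd // ord1.
Qed.

Definition strip_manifold : complexManifold R := ComplexManifold strip_axioms.

End StripSpace.

(** * Holomorphic functions and the Kobayashi-Royden pseudometric on the strip *)

Section StripExample.
Variable R : realType.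
Local Notation S := (strip_manifold R).

Definition strip_fun (F : R[i] -> R[i]) : S -> complex_plane R :=
  fun z => F (val (z : strip R)).

Lemma holomorphic_strip_fun (F dF : R[i] -> R[i]) :
  (forall w, cdiff F w (dF w)) -> holomorphic (strip_fun F) /\
  forall (z : S) (xi : tangent z), (differential (strip_fun F) xi : R[i]) =
    dF (val (z : strip R)) * (xi : 'rV[R[i]]_1) 0 0.
Proof.
move=> HF.
pose co (v : 'rV[R[i]]_1) : R[i] := v 0 0.
have dco (v : 'rV[R[i]]_1) : differentiable co v /\ 'd co v = co :> ('rV[R[i]]_1 -> R[i]).
  have lco : linear co by move=> a u w; rewrite /co !mxE.
  pose coL := GRing.isLinear.Build _ _ _ _ _ lco.
  pose cL : {linear 'rV[R[i]]_1 -> R[i]} := HB.pack co coL.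
  have cc : continuous cL by exact: coord_continuous.
  split; first exact: (@linear_differentiable _ _ _ cL v cc).
  exact: (@diff_lin _ _ _ cL v cc).
have main (z : S) : differentiable (local_rep (strip_fun F) z) (chart z z) /\
  forall xi : 'rV[R[i]]_1, 'd (local_rep (strip_fun F) z) (chart z z) xi =
    dF (val (z : strip R)) * xi 0 0.
  pose v : 'rV[R[i]]_1 := const_mx (val (z : strip R)).
  have vE : co v = val (z : strip R) by rewrite /co mxE.
  have E : {near v, F \o co =1 local_rep (strip_fun F) z}.
    apply/nbhs_row1P; have [e e0 He] := near_strip z; exists e => // u.
    rewrite mxE => /He u1.
    by rewrite /local_rep /= /strip_fun strip_insubd.
  have [dF1 dF2] : differentiable (F \o co) v /\ forall xi, 'd (F \o co) v xi = dF (co v) * co xi.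
    split; first by have [] := diff_comp_cplx 0 (proj1 (dco v)) (HF (co v)).
    move=> xi; have [_ H] := diff_comp_cplx xi (proj1 (dco v)) (HF (co v)).
    apply: (etrans H).
    exact: (congr1 (fun h : 'rV[R[i]]_1 -> R[i] => dF (co v) * h xi) (proj2 (dco v))).
  have [d1 d2] := near_eq_diff E dF1; split; first exact: d1.
  move=> xi; apply: (etrans (congr1 (fun h : 'rV[R[i]]_1 -> R[i] => h xi) d2)).
  by apply: (etrans (dF2 xi)); rewrite vE.
split; last by move=> z xi; exact: (proj2 (main z)).
move=> z _; split; last exact: (proj1 (main z)).
have cv : {for z, continuous (val : strip_top R -> R[i])}.
  exact: (@initial_continuous _ _ (val : strip R -> R[i]) z).
have cF : {for val (z : strip_top R), continuous F} := (continuousCP _ _).2 (cdiff_cont (HF _)).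
exact: (continuous_comp cv cF).
Qed.

(** On the strip 1 - i w has real part 1 + Im w, between 0 and 2, so Borel-Caratheodory on the unit
    disk gives |a xi| <= 4 for every analytic disk through z. *)
Lemma strip_kobayashi_ge (z : S) (xi : tangent z) :
  normc ((xi : 'rV[R[i]]_1) 0 0) / 4 <= kobayashi xi.
Proof.
apply: kobayashi_ge => phi a hphi phi0 a0 dphi.
have [hpr dpr] := holomorphic_strip_fun (fun w => cdiff_id w).
pose h (w : R[i]) : R[i] := 1 - 'i%C * (strip_fun id (phi w) : R[i]).
have N0 : normc (0 : R[i]) < 1 by rewrite Normc.normc0.
have dh w : normc w < 1 -> cdiff h w (0 - 'i%C *
    (differential (strip_fun id) (@differential _ _ _ _ _ phi w 1) : R[i])).
  by move=> w1; apply: cdiffB (cdiff_cst _ _) (cdiffMl _ (cdiff_disk hpr hphi w1)).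
have reh w : cRe (h w) = 1 + cIm (strip_fun id (phi w) : R[i]).
  by rewrite /h cReD cReN cReM /= mul0r mul1r sub0r opprK.
have im w : `|cIm (strip_fun id (phi w) : R[i])| < 1 by exact: (valP (phi w : strip R)).
have dh' w : normc (w - 0) < 1 -> exists c, cdiff h w c.
  by rewrite subr0 => /dh; eexists; eassumption.
have pos w : normc (w - 0) < 1 -> 0 <= cRe (h w).
  by move=> _; rewrite reh; have := im w; rewrite ltr_norml => /andP[]; lra.
have := positive_re_deriv ltr01 dh' pos (dh 0 N0).
have i1 : normc ('i%C : R[i]) = 1 by rewrite /= expr0n /= expr1n add0r sqrtr1.
rewrite reh dpr dphi mul1r mul1r sub0r normcN normcM mxE normcM i1 mul1r => H.
have n0 : 0 < normc a by rewrite normc_gt0.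
rewrite ler_pdivrMr // mulrC ler_pdivlMr // mulrC.
apply: (le_trans H); have := im 0; rewrite ltr_norml => /andP[_]; lra.
Qed.

Lemma strip_nondegenerate : kobayashi_nondegenerate S.
Proof.
move=> z xi xi0; apply: lt_le_trans (strip_kobayashi_ge xi).
rewrite divr_gt0 // normc_gt0; apply: contra xi0 => /eqP x0.
by apply/eqP/rowP => i; rewrite ord1 x0 mxE.
Qed.

Definition strip_real (u : R) : strip R :=
  @exist _ (fun w : R[i] => `|cIm w| < 1) u%:C
    (eq_ind_r (fun x => x < 1) ltr01 (normr0 R)).

Definition unit_vec : 'rV[R[i]]_1 := const_mx 1.

(** The unit disk about a real point lies in the strip. *)
Lemma strip_kobayashi_real (u : R) : kobayashi (unit_vec : tangent (strip_real u : S)) <= 1.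
Proof.
have [w w1|phi [h1 h2 h3]] :=
  @affine_disk R S (strip_real u) (unit_vec : tangent (strip_real u : S)) 1.
  have im : `|cIm (u%:C + w)| < 1.
    rewrite cImD /= add0r; exact: le_lt_trans (normc_Im w) w1.
  exists (insubd (strip_real u) (u%:C + w)) => //.
  apply/rowP => i; rewrite /= !mxE strip_insubd // !mulr1.
  by [].
have := kobayashi_le h1 h2 (oner_neq0 _) h3.
by rewrite Normc.normc1 invr1.
Qed.

End StripExample.

(** * The two quadratic examples *)

Section StripFunctions.
Variable R : realType.
Local Notation S := (strip_manifold R).

(** For a = 2i the imaginary part of w + a stays away from 0, so the real part of lambda (w + a)^2
    grows at least linearly for every lambda != 0 and the exponential compensates the linear
    derivative. For a = 0 and lambda = i that real part vanishes on the real axis. *)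
Definition sq_shift (a w : R[i]) : R[i] := (w + a) * (w + a).

Lemma cdiff_sq_shift (a w : R[i]) : cdiff (sq_shift a) w (2 * (w + a)).
Proof.
have H : cdiff (fun w => w + a) w 1.
  by have := cdiffD (cdiff_id w) (cdiff_cst a w); rewrite addr0.
by have := cdiffM H H; rewrite mul1r mulr1 -mulr2n mulr_natl.
Qed.

(** The left side is even in x, and e^y >= 1 + y for y >= 0. This rate is enough against a
    derivative of linear growth. *)
Lemma expR_ratio (x : R) : expR x / (1 + expR x ^+ 2) <= (1 + `|x|)^-1.
Proof.
have pos y : 0 <= y -> expR y / (1 + expR y ^+ 2) <= (1 + y)^-1.
  move=> y0; have E1 := expR_ge1Dx y; have E0 := expR_gt0 y.
  have E2 : 0 < 1 + expR y ^+ 2 by rewrite ltr_pwDl ?sqr_ge0.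
  have y1 : 0 < 1 + y by lra.
  rewrite ler_pdivrMr // mulrC ler_pdivlMr //; nra.
have [x0|x0] := leP 0 x; first by rewrite ger0_norm // pos.
have -> : expR x / (1 + expR x ^+ 2) = expR (- x) / (1 + expR (- x) ^+ 2).
  rewrite expRN; have := expR_gt0 x; set E := expR x => E0.
  have E2 : 0 < 1 + E ^+ 2 by rewrite ltr_pwDl ?sqr_ge0.
  by field; rewrite !gt_eqF // addrC.
by rewrite ltr0_norm // pos; lra.
Qed.

(* The real part of lambda (w + 2i)^2 is al (u^2 - v^2) - 2 be u v, with
   lambda = al + i be and w + 2i = u + i v, 1 < v < 3. *)
Lemma strip_re_growth (al be : R) : al != 0 \/ be != 0 -> exists2 C : R, 0 <= C &
  forall u v : R, 1 <= v <= 3 ->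
    `|u| + 3 <= C * (1 + `|al * (u ^+ 2 - v ^+ 2) - 2 * be * u * v|).
Proof.
have [->|al0 _] := eqVneq al 0.
  move=> [/eqP//|be0]; have b0 : 0 < `|be| by rewrite normr_gt0.
  exists (3 + `|be|^-1) => [|u v /andP[v1 v3]]; first by rewrite addr_ge0 // invr_ge0.
  rewrite mul0r sub0r normrN !normrM (ger0_norm (ler0n _ 2)) (@ger0_norm _ v); last by lra.
  have u0 := normr_ge0 u.
  have -> : (3 + `|be|^-1) * (1 + 2 * `|be| * `|u| * v) =
    3 + `|be|^-1 + 6 * `|be| * `|u| * v + 2 * `|u| * v.
    by field; rewrite gt_eqF.
  have : 0 <= `|be|^-1 by rewrite invr_ge0.
  have : 0 <= `|be| * `|u| * v by rewrite !mulr_ge0 //; lra.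
  have : `|u| <= `|u| * v by rewrite ler_peMr.
  by nra.
have a0 : 0 < `|al| by rewrite normr_gt0.
(* Read off from [bound] after division by |al|; the numbers 9 and 6 come from v <= 3. *)
exists (4 + (1 + 9 * `|al| + 6 * `|be|) / `|al|) => [|u v /andP[v1 v3]].
  by rewrite addr_ge0 // divr_ge0 // !addr_ge0 // mulr_ge0.
set X := al * _ - _.
have X0 := normr_ge0 X; have u0 := normr_ge0 u; have b0 := normr_ge0 be.
have aX : `|al| * `|u| ^+ 2 <= `|X| + 9 * `|al| + 6 * `|be| * `|u|.
  have -> : `|al| * `|u| ^+ 2 = `|al * u ^+ 2| by rewrite normrM normrX.
  have -> : al * u ^+ 2 = X + (al * v ^+ 2 + 2 * be * u * v) by rewrite /X; ring.
  apply: (le_trans (ler_normD _ _)); rewrite -addrA lerD2l.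
  apply: (le_trans (ler_normD _ _)); rewrite !normrM (ger0_norm (ler0n _ 2)).
  rewrite (@ger0_norm _ v); last by lra.
  apply: lerD.
    by rewrite mulrC ler_wpM2r //; nra.
  have : 0 <= `|be| * `|u| by rewrite mulr_ge0.
  by nra.
(* For |u| > 1 this is the quadratic estimate [aX] divided by |u|; for |u| <= 1 it is immediate. *)
have bound : `|al| * `|u| <= `|al| + (`|X| + 9 * `|al| + 6 * `|be|).
  have [u1|u1] := leP `|u| 1.
    have : 0 <= 9 * `|al| + 6 * `|be| by rewrite addr_ge0 // mulr_ge0 // ltW.
    by nra.
  have : `|al| * `|u| ^+ 2 <= (`|X| + 9 * `|al| + 6 * `|be|) * `|u|.
    apply: (le_trans aX); rewrite !mulrDl.
    have : `|X| <= `|X| * `|u| by rewrite ler_peMr // ltW.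
    have : `|al| <= `|al| * `|u| by rewrite ler_peMr // ltW.
    by lra.
  rewrite expr2 mulrA ler_pM2r; last by lra.
  by lra.
set q := (_ + _ + _) / _.
have qE : q * `|al| = 1 + 9 * `|al| + 6 * `|be| by rewrite divfK // gt_eqF.
rewrite -(ler_pM2l a0).
have -> : `|al| * ((4 + q) * (1 + `|X|)) = (4 * `|al| + q * `|al|) * (1 + `|X|) by ring.
rewrite qE mulrDr.
have : 0 <= (13 * `|al| + 6 * `|be|) * `|X|.
  by rewrite mulr_ge0 // addr_ge0 // mulr_ge0 // ltW.
by nra.
Qed.

Let f := strip_fun (sq_shift (Complex 0 2)).
Let g := strip_fun (sq_shift (0 : R[i])).

Let n2 : normc (2 : R[i]) = 2.
Proof. by rewrite -(rmorph_nat (real_complex R) 2) normcR ger0_norm. Qed.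

Lemma sq_shift_2i_semi_bloch : semi_bloch_functions S f.
Proof.
have [hf df] := holomorphic_strip_fun (cdiff_sq_shift (Complex 0 2)).
split=> // lambda; split; first by have [] := holomorphic_exp lambda hf.
have [l0|l0] := eqVneq lambda 0.
  exists 0 => z xi; rewrite spherical_exp // l0 Normc.normc0.
  by rewrite !(mulr0, mul0r).
have [|C C0 HC] := @strip_re_growth (cRe lambda) (cIm lambda).
  have [a0|] := eqVneq (cRe lambda) 0; [right|by left].
  by apply: contra l0 => /eqP b0; apply/eqP; apply: eq_ReIm.
(* A factor 4 comes from the 2 of the metric and the 2 of f', another 4 from
   [strip_kobayashi_ge]. *)
exists (16 * normc lambda * C) => z xi; rewrite spherical_exp // df.
have := strip_kobayashi_ge xi.
set x := normc (_ 0 0) => Hk; have x0 : 0 <= x by exact: normc_ge0.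
set w := val (z : strip R).
have wim : `|cIm w| < 1 by exact: (valP (z : strip R)).
pose u := cRe w; pose v := cIm w + 2.
have v13 : 1 <= v <= 3.
  by move: wim; rewrite ltr_norml /v => /andP[? ?]; apply/andP; split; lra.
have := HC u v v13.
have -> : cRe lambda * (u ^+ 2 - v ^+ 2) - 2 * cIm lambda * u * v =
    cRe (lambda * (f z : R[i])).
  rewrite /f /strip_fun /sq_shift -/w !(cReM, cImM, cReD, cImD) /= -/v addr0 -/u; ring.
set X := cRe _ => HX; have L0 := normc_ge0 lambda.
have w2 : normc (w + Complex 0 2) <= `|u| + 3.
  apply: (le_trans (normc_le_ReIm _)); rewrite cReD cImD /= addr0 -/u -/v lerD2l.
  by rewrite ger0_norm; lra.
rewrite !normcM -/x.
rewrite n2.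
have -> : 2 * (expR X * normc lambda * (2 * normc (w + Complex 0 2) * x)) /
    (1 + expR X ^+ 2) =
  4 * normc lambda * x * (expR X / (1 + expR X ^+ 2) * normc (w + Complex 0 2)).
  ring.
have X1 : 0 < 1 + `|X| by rewrite ltr_pwDl.
have key : expR X / (1 + expR X ^+ 2) * normc (w + Complex 0 2) <= C.
  apply: (le_trans (_ : _ <= (1 + `|X|)^-1 * (`|u| + 3))).
    apply: ler_pM w2; [|exact: normc_ge0|exact: expR_ratio].
    by apply: divr_ge0; [exact: expR_ge0|rewrite addr_ge0 ?sqr_ge0].
  by rewrite mulrC ler_pdivrMr.
apply: (le_trans (ler_wpM2l _ key)); first by rewrite !mulr_ge0.
have -> : 16 * normc lambda * C * kobayashi xi =
  4 * normc lambda * C * (4 * kobayashi xi) by ring.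
rewrite mulrAC ler_wpM2l ?mulr_ge0 //; lra.
Qed.

Let unit00 : (unit_vec R) 0 0 = 1. Proof. by rewrite mxE. Qed.

(** Along the real axis |f'| is unbounded, while the unit vector keeps Kobayashi length at most
    1. *)
Lemma sq_shift_2i_not_bloch : ~ bloch_functions S f.
Proof.
have [hf df] := holomorphic_strip_fun (cdiff_sq_shift (Complex 0 2)).
move=> [_ [C HC]]; pose u := `|C| + 1.
have := HC (strip_real u) (unit_vec R); rewrite df unit00 mulr1 normcM n2.
have := strip_kobayashi_real u; have := kobayashi_ge0 (unit_vec R : tangent (strip_real u : S)).
set k := kobayashi _ => k0 k1.
have C0 := normr_ge0 C.
have : u <= normc (val (strip_real u) + Complex 0 2).
  have := normc_Re (val (strip_real u) + Complex 0 2).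
  have -> : cRe (val (strip_real u) + Complex 0 2) = u by rewrite cReD /= addr0.
  by rewrite ger0_norm // addr_ge0.
set N := normc _ => uN H.
have : C * k <= `|C|.
  by apply: (le_trans (ler_norm _)); rewrite normrM (ger0_norm k0) ler_piMr.
by rewrite /u in uN; lra.
Qed.

(** The derivative 2 w is dominated by the denominator 1 + |w|^4 of the spherical metric. *)
Lemma sq_shift_0_normal : normal_functions S g.
Proof.
have [hg dg] := holomorphic_strip_fun (cdiff_sq_shift 0).
split; first exact: hg.
split; first exact: holomorphic_to_sphere.
exists 16 => z xi; rewrite /spherical_metric.
have := strip_kobayashi_ge xi.
have -> : (@differential _ _ _ _ _ (@to_sphere R \o g) z xi : R[i]) =
  2 * (val (z : strip R) + 0) * (xi : 'rV[R[i]]_1) 0 0 := dg z xi.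
have -> : chart ((@to_sphere R \o g) z) ((@to_sphere R \o g) z) =
  sq_shift 0 (val (z : strip R)) by [].
rewrite /sq_shift addr0 !normcM n2; set x := normc (_ 0 0); set w := normc _ => Hk.
have x0 : 0 <= x by exact: normc_ge0.
have w0 : 0 <= w by exact: normc_ge0.
have W : w <= 1 + (w * w) ^+ 2.
  rewrite -subr_ge0 (_ : _ - _ = (w ^+ 2 - 1 / 2) ^+ 2 + (w - 1 / 2) ^+ 2 + 1 / 2).
    by rewrite !addr_ge0 // sqr_ge0.
  by field.
rewrite ler_pdivrMr; last by rewrite ltr_pwDl ?sqr_ge0.
have -> : 2 * (2 * w * x) = 4 * x * w by ring.
apply: (le_trans (ler_wpM2l _ W)); first by rewrite mulr_ge0.
by rewrite ler_wpM2r ?addr_ge0 ?sqr_ge0 //; lra.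
Qed.

(** Since exp(i g) has modulus 1 on the real axis, its spherical derivative there is |g'|, which is
    unbounded. *)
Lemma sq_shift_0_not_semi_bloch : ~ semi_bloch_functions S g.
Proof.
have [hg dg] := holomorphic_strip_fun (cdiff_sq_shift 0).
have [lam lam1 lamRe] : exists2 lam : R[i], normc lam = 1 &
    forall x : R, cRe (lam * x%:C) = 0.
  exists 'i%C => [|x]; first by rewrite /= expr0n /= expr1n add0r sqrtr1.
  by rewrite cReM /= mul0r mul1r subrr.
move=> [_ /(_ lam)[_ [C HC]]]; pose u := `|C| + 1.
have C0 := normr_ge0 C.
have gu : (strip_fun (sq_shift 0) (strip_real u) : R[i]) = (u * u)%:C.
  by rewrite /strip_fun /sq_shift addr0 rmorphM.
have := HC (strip_real u) (unit_vec R).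
rewrite (spherical_exp _ _ hg) dg unit00 mulr1 normcM n2 gu lamRe lam1 expR0.
have -> : normc (val (strip_real u) + 0) = u.
  by rewrite addr0 normcR ger0_norm // /u addr_ge0.
have := strip_kobayashi_real u; have := kobayashi_ge0 (unit_vec R : tangent (strip_real u : S)).
set k := kobayashi _ => k0 k1.
have : C * k <= `|C|.
  by apply: (le_trans (ler_norm _)); rewrite normrM (ger0_norm k0) ler_piMr.
rewrite expr1n !mul1r /u => H1 H2.
have : 2 * (2 * (`|C| + 1)) / (1 + 1) = 2 * (`|C| + 1) by field.
by lra.
Qed.

End StripFunctions.

Theorem proposition4p8 (R : realType) :
  (forall M : complexManifold R, kobayashi_nondegenerate M ->
    bloch_functions M `<=` semi_bloch_functions M /\
    semi_bloch_functions M `<=` normal_functions M) /\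
  (exists M : complexManifold R, [/\ kobayashi_nondegenerate M,
    bloch_functions M `<` semi_bloch_functions M &
    semi_bloch_functions M `<` normal_functions M]).
Proof.
split=> [M _|]; first by split; [exact: bloch_semi_bloch|exact: semi_bloch_normal].
exists (strip_manifold R); split; first exact: strip_nondegenerate.
- split; first exact: bloch_semi_bloch.
  by move=> H; exact: sq_shift_2i_not_bloch (H _ (@sq_shift_2i_semi_bloch R)).
- split; first exact: semi_bloch_normal.
  by move=> H; exact: sq_shift_0_not_semi_bloch (H _ (@sq_shift_0_normal R)).
Qed.
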